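(* Let $G$ be a unimodular locally compact Spector-Vilenkin group with associated sequence $(G_k)_{k\in I}$, where $I=\mathbb{Z}$ or $I=\mathbb{N}$, and let $C_0>0$ be a constant. Let $\mathscr{K}$ be the set of all $K\in\mathrm{L}^1(G)$ such that $$\int_G\operatorname*{ess\,sup}_{r\in G:\,|s|\le|r|}|K(r)|\,ds\le C_0.$$ Suppose that $1<p<\infty$. Then the family $\mathscr{T}_{\mathscr{K}}=\{f\mapsto K*f:K\in\mathscr{K}\}$ of convolution operators acting on $\mathrm{L}^p(G)$ is $R$-bounded, and $$\mathscr{R}_p(\mathscr{T}_{\mathscr{K}})\le C_{G,p}$$ for some constant $C_{G,p}$ (depending only on $G$, $p$ and $C_0$).
   Context: **Spector-Vilenkin groups.** A Hausdorff topological group $G$ with identity $e$ is a locally compact Spector-Vilenkin group if there is a strictly decreasing sequence $(G_k)_{k\in I}$ of compact open subgroups of $G$, with $I=\mathbb{Z}$, $I=\mathbb{N}=\{0,1,2,\dots\}$ or $I=-\mathbb{N}$ (ordered as subsets of $\mathbb{R}$), such that $\bigcup_{k\in I}G_k=G$ and $\bigcap_{k\in I}G_k=\{e\}$. Let $\mu_G$ (written $ds$) be a left Haar measure with $\mu_G(G_0)=1$. For $s\in G_k\setminus G_{k+1}$ ($k\in I$) put $|s|=\mu_G(G_k)$, and $|e|=0$. **Convolution.** $(K*f)(s)=\int_GK(t)f(t^{-1}s)\,d\mu_G(t)$. **$R$-boundedness.** A set $\mathcal{F}$ of bounded operators on a Banach space $X$ is $R$-bounded if there is $C\ge0$ such that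 for all $N\ge1$, $T_1,\dots,T_N\in\mathcal{F}$, $x_1,\dots,x_N\in X$, $\|\sum_{k=1}^N\varepsilon_k\otimes T_k(x_k)\|_{\mathrm{L}^p(\Omega,X)}\le C\|\sum_{k=1}^N\varepsilon_k\otimes x_k\|_{\mathrm{L}^p(\Omega,X)}$, where $(\varepsilon_k)$ is a sequence of independent Rademacher variables on a probability space $\Omega$; the best constant is $\mathscr{R}_p(\mathcal{F})$. *)

(* Defs.v *)
From HB Require Import structures.
From mathcomp Require Import all_boot all_order all_algebra.
From mathcomp Require Import all_classical all_reals all_analysis.
From mathcomp Require Import ess_sup_inf complex.

Set Implicit Arguments.
Unset Strict Implicit.
Unset Printing Implicit Defensive.

Import Order.TTheory GRing.Theory Num.Theory.

Local Open Scope classical_set_scope.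
Local Open Scope ring_scope.

HB.mixin Record isTopologicalGroup G & Topological G & Group G := {
  mulg_continuous : continuous (fun x : G * G => (x.1 * x.2)%g) ;
  invg_continuous : continuous (fun x : G => (x^-1)%g) }.

#[short(type="topologicalGroupType")]
HB.structure Definition TopologicalGroup :=
  {G of isTopologicalGroup G & Topological G & Group G}.

(* Measurable types are pointed; a group is pointed by its identity. *)
Definition pointed_group (G : Type) : Type := G.
HB.instance Definition _ (G : topologicalGroupType) :=
  Choice.on (pointed_group G).
HB.instance Definition _ (G : topologicalGroupType) :=
  isPointed.Build (pointed_group G) (1%g : G).

Definition borel (G : topologicalGroupType) :=
  @g_sigma_algebraType (pointed_group G) (@open G).
HB.instance Definition _ (G : topologicalGroupType) := Measurable.on (borel G).

Definition is_subgroup (G : groupType) (A : set G) : Prop :=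
  [/\ A 1%g, (forall x y, A x -> A y -> A (x * y)%g)
    & (forall x, A x -> A (x^-1)%g)].

Section haar.
Context (R : realType) (G : topologicalGroupType).
Implicit Types mu : {measure set (borel G) -> \bar R}.

Definition left_invariant mu : Prop :=
  forall (g : G) (A : set (borel G)), measurable A ->
    mu [set (g * x)%g | x in (A : set G)] = mu A.

Definition right_invariant mu : Prop :=
  forall (g : G) (A : set (borel G)), measurable A ->
    mu [set (x * g)%g | x in (A : set G)] = mu A.

Definition radon mu : Prop :=
  [/\ forall A : set G, compact A -> (mu A < +oo)%E,
      forall A : set (borel G), measurable A ->
        mu A = ereal_inf [set mu U | U in [set U : set G | open U /\ A `<=` U]]
    & forall U : set G, open U ->
        mu U = ereal_sup [set mu A | A in [set A : set G | compact A /\ A `<=` U]]].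

Definition left_haar mu : Prop :=
  [/\ radon mu, left_invariant mu & mu [set: borel G] != 0%E].

End haar.

Definition unimodular (R : realType) (G : topologicalGroupType) : Prop :=
  forall mu : {measure set (borel G) -> \bar R},
    left_haar mu -> right_invariant mu.

(* The index set [I] is a subset of [int]; only the values [Gk k] with [I k]
   are meaningful. *)
Record spector_vilenkin (G : topologicalGroupType) (I : set int)
    (Gk : int -> set G) : Prop := SpectorVilenkin {
  sv_hausdorff : hausdorff_space G ;
  sv_index : [\/ I = [set: int], I = [set k | 0 <= k] | I = [set k | k <= 0]] ;
  sv_subgroup : forall k, I k -> is_subgroup (Gk k) ;
  sv_compact : forall k, I k -> compact (Gk k) ;
  sv_open : forall k, I k -> open (Gk k) ;
  sv_decr : forall k l, I k -> I l -> k < l -> Gk l `<` Gk k ;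
  sv_bigcup : \bigcup_(k in I) Gk k = [set: G] ;
  sv_bigcap : \bigcap_(k in I) Gk k = [set 1%g] }.

(* [|s|]; meaningful when [I] is closed under successor, see [sv_absE]. *)
Definition sv_abs (R : realType) (G : topologicalGroupType)
    (mu : {measure set (borel G) -> \bar R}) (I : set int)
    (Gk : int -> set G) (s : G) : \bar R :=
  if s == 1%g then 0%E
  else mu (Gk (xget 0 [set k | I k /\ (Gk k `\` Gk (k + 1)) s])).

Lemma sv_absE (R : realType) (G : topologicalGroupType)
    (mu : {measure set (borel G) -> \bar R}) (I : set int)
    (Gk : int -> set G) (k : int) (s : G) :
  spector_vilenkin I Gk -> (forall j, I j -> I (j + 1)) ->
  I k -> (Gk k `\` Gk (k + 1)) s -> sv_abs mu I Gk s = mu (Gk k).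
Proof.
move=> sv IS Ik ks; rewrite /sv_abs.
have lt_absurd i j : I i -> I j -> (Gk i `\` Gk (i + 1)) s ->
    (Gk j `\` Gk (j + 1)) s -> i < j -> False.
  move=> Ii Ij [_ nis] [js _]; rewrite -lezD1 le_eqVlt => /orP[/eqP ij|ij].
    by apply: nis; rewrite ij.
  by apply: nis; have [+ _] := sv_decr sv (IS _ Ii) Ij ij; exact.
case: eqP => [s1|_].
  by case: ks => _ []; rewrite s1; have [] := sv_subgroup sv (IS _ Ik).
set S := [set j | _]; have [Ij js] : S (xget 0 S) by apply: xgetPex; exists k.
by have [/(lt_absurd _ _ Ij Ik js ks)|/(lt_absurd _ _ Ik Ij ks js)|->] :=
  ltgtP (xget 0 S) k.
Qed.

Section complex_functions.
Context d (T : measurableType d) (R : realType).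
Variable mu : {measure set T -> \bar R}.

Definition cmeasurable (f : T -> R[i]) : Prop :=
  measurable_fun setT (fun x => complex.Re (f x)) /\
  measurable_fun setT (fun x => complex.Im (f x)).

Definition modulus (f : T -> R[i]) (x : T) : \bar R :=
  (ComplexField.Normc.normc (f x))%:E.

Definition Cnorm (p : \bar R) (f : T -> R[i]) : \bar R :=
  Lnorm mu p (modulus f).

(* Elements of L^p are represented by functions; functions at [Cnorm p]-distance
   zero represent the same element. *)
Definition CLp (p : \bar R) : set (T -> R[i]^o) :=
  [set f | cmeasurable f /\ (Cnorm p f < +oo)%E].

Definition Cintegral (f : T -> R[i]) : R[i] :=
  Complex (\int[mu]_x complex.Re (f x))%R (\int[mu]_x complex.Im (f x))%R.

End complex_functions.

Definition convolution (R : realType) (G : topologicalGroupType)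
    (mu : {measure set (borel G) -> \bar R}) (K f : G -> R[i]^o) : G -> R[i]^o :=
  fun s => Cintegral mu (fun t : G => K t * f (t^-1 * s)%g).

Section rademacher.
Context d (Omega : measurableType d) (R : realType) (P : probability Omega R).

Definition mutually_independent (X : nat -> {RV P >-> R}) : Prop :=
  forall (J : seq nat) (B : nat -> set R), uniq J ->
    (forall i, measurable (B i)) ->
    P (\bigcap_(i in [set` J]) (X i @^-1` B i)) =
    \big[mule/1%E]_(i <- J) P (X i @^-1` B i).

Definition rademacher_sequence (eps : nat -> {RV P >-> R}) : Prop :=
  mutually_independent eps /\
  forall k, P (eps k @^-1` [set 1]) = (2^-1)%:E /\
            P (eps k @^-1` [set - 1]) = (2^-1)%:E.

End rademacher.

(* A complex normed space is presented by a set [X] of representatives in a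
   module [V] and a seminorm [N], finite on [X]: vectors [x], [y] of [X] with
   [N (x - y) = 0] are identified.  Operators act on representatives. *)
Section R_boundedness.
Context (R : realType) (V : lmodType R[i]) (X : set V) (N : V -> \bar R).

Definition bounded_operator (T : V -> V) : Prop :=
  [/\ forall x, X x -> X (T x),
      forall (a : R[i]) x y, X x -> X y ->
        N (T (a *: x + y) - (a *: T x + T y)) = 0%E
    & exists C : R, forall x, X x -> (N (T x) <= C%:E * N x)%E].

Context d (Omega : measurableType d) (P : probability Omega R).
Variables (eps : nat -> {RV P >-> R}) (p : R) (F : set (V -> V)).

Definition rademacher_norm (n : nat) (x : 'I_n -> V) : \bar R :=
  Lnorm P p%:E (fun w => N (\sum_(k < n) real_complex R (eps k w) *: x k)).

Definition R_bound (C : R) : Prop :=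
  0 <= C /\
  forall (n : nat) (T : 'I_n -> V -> V) (x : 'I_n -> V), (0 < n)%N ->
    (forall k, F (T k)) -> (forall k, X (x k)) ->
    (rademacher_norm (fun k => T k (x k)) <= C%:E * rademacher_norm x)%E.

Definition R_bounded : Prop :=
  (forall T, F T -> bounded_operator T) /\ exists C : R, R_bound C.

Definition R_constant : \bar R := ereal_inf [set C%:E | C in R_bound].

End R_boundedness.

Section kernels.
Context (R : realType) (G : topologicalGroupType).
Variables (mu : {measure set (borel G) -> \bar R}) (I : set int)
          (Gk : int -> set G).
Local Notation abs := (sv_abs mu I Gk).

(* The essential supremum of [|K r|] over the [r] with [|s| <= |r|]: the value
   [-oo] elsewhere makes the other [r] irrelevant. *)
Definition radial_majorant (K : G -> R[i]) (s : G) : \bar R :=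
  ess_sup mu (fun r : borel G =>
    if (abs s <= abs r)%E then modulus (K : borel G -> R[i]) r else -oo%E).

Definition kernels (C0 : R) : set (G -> R[i]^o) :=
  [set K | CLp mu 1%E K /\
           (\int[mu]_s radial_majorant K s <= C0%:E)%E].

Definition convolution_operators (C0 : R) :
    set ((G -> R[i]^o) -> (G -> R[i]^o)) :=
  [set convolution mu K | K in kernels C0].

End kernels.

(* Main.v *)
Require Import Defs.
From HB Require Import structures.
From mathcomp Require Import all_boot all_order all_algebra.
From mathcomp Require Import all_classical all_reals all_analysis.
From mathcomp Require Import complex.
From mathcomp Require Import ess_sup_inf measurable_realfun hoelder ring lra zify.

Set Implicit Arguments.
Unset Strict Implicit.
Unset Printing Implicit Defensive.

Import Order.TTheory GRing.Theory Num.Theory.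

Local Open Scope classical_set_scope.
Local Open Scope ring_scope.

(** With [E_k f s] the average of [f] over the coset [G_k s], i.e.
    [E_k f s = mu(G_k)^-1 * int_{G_k} f (t^-1 s) dt], the [E_k] are the conditional
    expectations of a filtration, and [|K * f| <= \sum_k a_k E_k |f|] with
    [a_k = mu(G_k) * ess sup of |K| off G_(k+1)] and [\sum_k a_k <= 2 C0], because
    [mu (G_k \ G_(k+1)) >= mu(G_k) / 2].  By Khintchine's inequalities it is enough to
    bound [(\sum_j (A_j f_j)^2)^(1/2)] in [L^p], [A_j = \sum_k a_jk E_k].
    For [p >= 2], Cauchy-Schwarz and Jensen give
    [\sum_j (A_j f_j)^2 <= 2 C0 \sum_k E_k F_k] with [F_k = \sum_j a_jk f_j^2], and
    the dual Doob inequality [|| \sum_k E_k F_k ||_r <= C ||\sum_k F_k||_r], [r = p / 2],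
    follows by telescoping [r]-th powers of the partial sums, which are measurable for
    the [k]-th sigma-algebra.  For [p < 2] one dualizes, the [A_j] being self-adjoint. *)

(** * Real inequalities *)

(** The duality step and the dual Doob inequality both end with the quantity to be estimated on both
    sides, with factor 1/2 on the right. Cancelling it requires that quantity to be finite. This
    dictates the order of the proof: finite combinations of averages are treated first, on bounded
    functions supported in a single subgroup, where every integral is a real number, and with
    constants that do not see the number of terms. Fatou's lemma then reaches general functions and
    kernels. The convolution integral may diverge at some points. It is therefore only compared from
    below with the integral of the product of the moduli, an extended real. That this integral is
    finite almost everywhere is itself deduced from the square function bound, and it gives
    linearity of the operators up to null sets. Khintchine's inequalities can be used pointwise on
    the group because the same exponent [p] is taken over the probability space and over the group.
    The 2 in [2 C0] reflects that a proper subgroup has index at least 2: a full coset of the next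
    subgroup sits in each annulus. *)

Section real_inequalities.
Context {R : realType}.
Implicit Types (a b x y p q r d c : R).

Lemma powR_le a b p : 0 <= p -> 0 <= a -> a <= b -> a `^ p <= b `^ p.
Proof.
by move=> p0 a0 ab; apply: ge0_ler_powR; rewrite ?nnegrE// (le_trans a0).
Qed.

(** Bernoulli's inequality; it supplies the linear lower bound for [x ^+ m] used in the next
    lemma. *)
Lemma subr1_expr_le (x : R) n : 0 <= x <= 1 -> 1 - x ^+ n <= n%:R * (1 - x).
Proof.
move=> /andP[x0 x1]; elim: n => [|n IH]; first by rewrite expr0 mul0r subrr.
have := exprn_ge0 n x0; have := exprn_ile1 n x0 x1.
by rewrite exprS -natr1; nra.
Qed.

(* A form of the mean value inequality; the constant comes from comparing [x `^ r]
   with an integer power [x ^+ m], [r <= m], for [0 <= x <= 1]. *)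
Lemma powR_increment_le r : 1 <= r -> exists2 c, 0 <= c &
  forall a b, 0 <= a -> a <= b -> b `^ r <= a `^ r + c * ((b - a) * b `^ (r - 1)).
Proof.
move=> r1; pose m := (Num.truncn r).+1.
have rm : r <= m%:R by apply/ltW/truncnS_gt.
exists m%:R => // a b a0 ab.
have [b0|b0] := eqVneq b 0.
  have -> : a = b by apply/eqP; rewrite eq_le ab b0 a0.
  by rewrite subrr mul0r mulr0 addr0.
have {}b0 : 0 < b by rewrite lt_def b0 (le_trans a0).
have xI : 0 <= a / b <= 1 by rewrite divr_ge0 ?(ltW b0)//= ler_pdivrMr ?mul1r.
have r0 : 0 < r by lra.
have -> : a `^ r = (a / b) `^ r * b `^ r.
  by rewrite -powRM ?divfK ?gt_eqF ?(ltW b0)//; case/andP: xI.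
rewrite mulrA -[b `^ r in leRHS](mulr_powRB1 (ltW b0) r0).
rewrite -{1}[b `^ r](mulr_powRB1 (ltW b0) r0).
have Q0 : 0 <= b `^ (r - 1) by apply: powR_ge0.
suff : b <= (a / b) `^ r * b + m%:R * (b - a).
  by move=> /ler_wpM2r -/(_ _ Q0); lra.
suff H : 1 - m%:R * (1 - a / b) <= (a / b) `^ r.
  have -> : b - a = (1 - a / b) * b by rewrite mulrBl mul1r divfK// gt_eqF.
  by nra.
have [->|ab0] := eqVneq (a / b) 0.
  rewrite subr0 mulr1 powR0 ?gt_eqF//.
  by rewrite subr_le0 ler1n.
have ab0' : 0 < a / b by rewrite lt_def ab0; case/andP: xI.
have /ger_powR/(_ _ _ rm) : 0 < a / b <= 1 by rewrite ab0'; case/andP: xI.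
rewrite powR_mulrn ?(ltW ab0')//.
by have := subr1_expr_le m xI; lra.
Qed.

(** Split at [x = d * y]: below it the product is at most [d * y ^ r]; above it [y < x / d], which
    gives the constant [d ^ (1 - r)]. This covers [r = 1], where Young's inequality would have an
    infinite conjugate exponent. *)
Lemma mul_powR_absorb r d : 1 <= r -> 0 < d -> exists2 c, 0 <= c &
  forall x y, 0 <= x -> 0 <= y -> x * y `^ (r - 1) <= c * x `^ r + d * y `^ r.
Proof.
move=> r1 d0; have r0 : 0 < r by lra.
exists (d `^ (1 - r)) => [|x y x0 y0]; first exact: powR_ge0.
have [xy|xy] := leP x (d * y).
  rewrite -(mulr_powRB1 y0 r0) mulrA.
  apply: le_trans (_ : d * y * y `^ (r - 1) <= _).
    by rewrite ler_wpM2r ?powR_ge0.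
  by rewrite lerDr mulr_ge0 ?powR_ge0.
apply: le_trans (_ : d `^ (1 - r) * x `^ r <= _); last first.
  by rewrite lerDl mulr_ge0 ?powR_ge0// ltW.
rewrite -(mulr_powRB1 x0 r0) mulrCA ler_wpM2l//.
rewrite -(opprB r 1) powRN mulrC ler_pdivlMr ?powR_gt0// -powRM ?(ltW d0)//.
by apply: powR_le; rewrite ?subr_ge0 ?mulr_ge0 ?(ltW d0)// mulrC ltW.
Qed.

Lemma mul_absorb p q d : 0 < p -> 0 < q -> p^-1 + q^-1 = 1 -> 0 < d ->
  exists2 c, 0 <= c & forall x y, 0 <= x -> 0 <= y ->
    x * y <= c * x `^ p + d * y `^ q.
Proof.
(* Young's inequality is applied to [e^-1 * x] and [e * y]; this [e] satisfies [e ^ q / q = d], so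
   the second term is exactly [d * y ^ q]. *)
move=> p0 q0 pq d0; pose e := (q * d) `^ q^-1.
have e0 : 0 < e by rewrite powR_gt0// mulr_gt0.
exists ((e^-1) `^ p / p) => [|x y x0 y0].
  by rewrite mulr_ge0 ?powR_ge0// invr_ge0 ltW.
have : x * y = (e^-1 * x) * (e * y) by rewrite mulrACA mulVf ?mul1r// gt_eqF.
move=> ->; apply: le_trans (conjugate_powR _ _ p0 q0 pq) _.
- by rewrite mulr_ge0// invr_ge0 ltW.
- by rewrite mulr_ge0// ltW.
rewrite !powRM ?invr_ge0 ?(ltW e0)// lerD//; first by rewrite mulrAC.
rewrite -powRrM mulVf ?gt_eqF// powRr1 ?mulr_ge0 ?(ltW q0) ?(ltW d0)//.
by rewrite mulrAC (mulrC q) mulfK// gt_eqF.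
Qed.

Lemma sumr_CauchySchwarz (J : Type) (s : seq J) (P : pred J) (w f g : J -> R) :
  (forall j, P j -> 0 <= w j) ->
  (\sum_(j <- s | P j) w j * (f j * g j)) ^+ 2 <=
  (\sum_(j <- s | P j) w j * f j ^+ 2) * (\sum_(j <- s | P j) w j * g j ^+ 2).
Proof.
move=> w0; set X := \sum_(j <- s | P j) w j * (f j * g j).
set A := \sum_(j <- s | P j) w j * f j ^+ 2.
set B := \sum_(j <- s | P j) w j * g j ^+ 2.
have quad t u : 0 <= t ^+ 2 * A - 2 * t * u * X + u ^+ 2 * B.
  suff -> : t ^+ 2 * A - 2 * t * u * X + u ^+ 2 * B =
     \sum_(j <- s | P j) w j * (t * f j - u * g j) ^+ 2.
    by apply: sumr_ge0 => j Pj; rewrite mulr_ge0 ?w0 ?sqr_ge0.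
  rewrite /A /B /X !mulr_sumr -sumrB -big_split /=.
  by apply: eq_bigr => j _; ring.
have A0 : 0 <= A by apply: sumr_ge0 => j Pj; rewrite mulr_ge0 ?w0 ?sqr_ge0.
have B0 : 0 <= B by apply: sumr_ge0 => j Pj; rewrite mulr_ge0 ?w0 ?sqr_ge0.
have [B00|Bn0] := eqVneq B 0.
  have [->|X0] := eqVneq X 0; first by rewrite expr0n B00 mulr0.
  (* With [B = 0] the form is affine in [u], and this choice gives it the value [A - (A + 1) = -1]:
     a nonzero [X] is impossible. *)
  have := quad 1 ((A + 1) / (2 * X)).
  have -> : 2 * 1 * ((A + 1) / (2 * X)) * X = A + 1 by field.
  by rewrite B00 mulr0; lra.
have Bp : 0 < B by rewrite lt_def Bn0.
have := quad B X.
have -> : B ^+ 2 * A - 2 * B * X * X + X ^+ 2 * B = B * (A * B - X ^+ 2) by ring.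
by rewrite pmulr_rge0// subr_ge0.
Qed.

Lemma sum_mul_absorb p q d : 0 < p -> 0 < q -> p^-1 + q^-1 = 1 -> 0 < d ->
  exists2 c, 0 <= c & forall (n : nat) (f g : 'I_n -> R),
    \sum_j f j * g j <=
    c * (\sum_j f j ^+ 2) `^ (p / 2) + d * (\sum_j g j ^+ 2) `^ (q / 2).
Proof.
move=> p0 q0 pq d0; have [c c0 H] := mul_absorb p0 q0 pq d0.
exists c => // n f g.
have F0 : 0 <= \sum_j f j ^+ 2 by apply: sumr_ge0 => j _; apply: sqr_ge0.
have G0 : 0 <= \sum_j g j ^+ 2 by apply: sumr_ge0 => j _; apply: sqr_ge0.
have := H _ _ (sqrtr_ge0 (\sum_j f j ^+ 2)) (sqrtr_ge0 (\sum_j g j ^+ 2)).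
rewrite -!powR12_sqrt// -!powRrM ![2^-1 * _]mulrC; apply: le_trans.
rewrite !powR12_sqrt// -sqrtrM// (le_trans (ler_norm _))// -sqrtr_sqr ler_wsqrtr//.
have := @sumr_CauchySchwarz _ (index_enum 'I_n) predT (fun=> 1) f g (fun _ _ => ler01).
by under eq_bigr do rewrite mul1r; under [X in _ <= X * _ -> _]eq_bigr do rewrite mul1r;
   under [X in _ <= _ * X -> _]eq_bigr do rewrite mul1r.
Qed.

Lemma powR_add_le x y p : 0 <= p -> 0 <= x -> 0 <= y ->
  (x + y) `^ p <= 2 `^ p * (x `^ p + y `^ p).
Proof.
move=> p0 x0 y0.
have [xy|yx] := leP x y.
  apply: le_trans (_ : (2 * y) `^ p <= _); first by apply: powR_le => //; lra.
  by rewrite powRM// ler_wpM2l ?powR_ge0// lerDr powR_ge0.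
apply: le_trans (_ : (2 * x) `^ p <= _); first by apply: powR_le => //; lra.
by rewrite powRM// ler_wpM2l ?powR_ge0// lerDl powR_ge0.
Qed.

End real_inequalities.

(** * Khintchine's inequalities *)

Section khintchine.
Context {R : realType}.
Implicit Types (p c : R).

(** The expectation of [f] in [n] independent Rademacher variables, written as a finite average so
    that no measurability of [f] enters. [rademacher_integral] links it to an actual sequence. *)
Definition sign_mean (n : nat) (f : ('I_n -> R) -> R) : R :=
  (2 ^+ n)^-1 * \sum_(s : {ffun 'I_n -> bool}) f (fun k => (-1) ^+ s k).

Lemma ler_sign_mean n (f g : ('I_n -> R) -> R) :
  (forall s, f s <= g s) -> sign_mean f <= sign_mean g.
Proof. by move=> fg; rewrite ler_wpM2l ?invr_ge0 ?exprn_ge0// ler_sum. Qed.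

Lemma sign_mean_ge0 n (f : ('I_n -> R) -> R) :
  (forall s, 0 <= f s) -> 0 <= sign_mean f.
Proof. by move=> f0; rewrite mulr_ge0 ?invr_ge0 ?exprn_ge0// sumr_ge0. Qed.

Lemma sign_meanD n (f g : ('I_n -> R) -> R) :
  sign_mean (fun s => f s + g s) = sign_mean f + sign_mean g.
Proof. by rewrite /sign_mean big_split mulrDr. Qed.

Lemma sign_meanZ n c (f : ('I_n -> R) -> R) :
  sign_mean (fun s => c * f s) = c * sign_mean f.
Proof. by rewrite /sign_mean -mulr_sumr mulrCA. Qed.

Lemma sign_mean_sum n (J : Type) (t : seq J) (f : J -> ('I_n -> R) -> R) :
  sign_mean (fun s => \sum_(j <- t) f j s) = \sum_(j <- t) sign_mean (f j).
Proof. by rewrite /sign_mean exchange_big mulr_sumr. Qed.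

(** Independence of the signs: expanding the product of two-term sums runs through every sign vector
    once. *)
Lemma sign_mean_prod n (f : 'I_n -> R -> R) :
  sign_mean (fun s => \prod_k f k (s k)) = \prod_k (2^-1 * (f k 1 + f k (-1))).
Proof.
rewrite big_split /= prodr_const card_ord exprVn; congr (_ * _).
transitivity (\prod_(k < n) \sum_(b : bool) f k ((-1) ^+ b)).
  by rewrite bigA_distr_bigA.
by apply: eq_bigr => k _; rewrite big_bool /= expr0 expr1 addrC.
Qed.

Lemma eq_sign_mean n (f g : ('I_n -> R) -> R) :
  (forall s, (forall k, s k ^+ 2 = 1) -> f s = g s) -> sign_mean f = sign_mean g.
Proof.
by move=> fg; congr (_ * _); apply: eq_bigr => s _; apply: fg => k; rewrite sqrr_sign.
Qed.

Lemma sign_mean_cst n c : @sign_mean n (fun=> c) = c.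
Proof.
rewrite /sign_mean sumr_const card_ffun card_bool card_ord -[X in _ * X]mulr_natl natrX.
by rewrite mulKf// expf_neq0// pnatr_eq0.
Qed.

Lemma sign_mean_opp n (f : ('I_n -> R) -> R) :
  sign_mean (fun s => f (fun k => - s k)) = sign_mean f.
Proof.
rewrite /sign_mean; congr (_ * _).
pose h (s : {ffun 'I_n -> bool}) := [ffun k => ~~ s k].
have hK : involutive h by move=> s; apply/ffunP => k; rewrite !ffunE negbK.
rewrite (reindex_inj (inv_inj hK)); apply: eq_bigr => s _; congr f.
by apply/funext => k; rewrite ffunE; case: (s k); rewrite ?expr0 ?expr1 ?opprK.
Qed.

Lemma sign_mean_cross n (i j : 'I_n) : i != j ->
  sign_mean (fun s => s i * s j) = 0.
Proof.
move=> ij; pose f (k : 'I_n) (t : R) := if k \in [:: i; j] then t else 1.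
have -> : (fun s : 'I_n -> R => s i * s j) = fun s => \prod_k f k (s k).
  apply/funext => s; rewrite (bigD1 i)// (bigD1 j) 1?eq_sym//= big1 => [|k].
    by rewrite mulr1 /f !inE !eqxx orbT.
  by rewrite /f !inE => /andP[/negbTE-> /negbTE->].
rewrite sign_mean_prod (bigD1 i)//= /f inE eqxx subrr mulr0.
by rewrite mul0r.
Qed.

(** Orthonormality of the signs: [s i * s j] has mean [1] on the diagonal and [0] off it. *)
Lemma sign_mean_sqr n (x : 'I_n -> R) :
  sign_mean (fun s => (\sum_k s k * x k) ^+ 2) = \sum_k x k ^+ 2.
Proof.
transitivity (sign_mean (fun s => \sum_i \sum_j x i * x j * (s i * s j))).
  congr sign_mean; apply/funext => s; rewrite expr2 mulr_suml.
  by apply: eq_bigr => i _; rewrite mulr_sumr; apply: eq_bigr => j _; ring.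
rewrite sign_mean_sum; apply: eq_bigr => i _; rewrite sign_mean_sum.
rewrite (bigD1 i)//= big1 ?addr0 => [|j ji]; rewrite sign_meanZ.
  rewrite (@eq_sign_mean _ _ (fun=> 1)) => [|s sE]; last by rewrite -expr2.
  by rewrite sign_mean_cst mulr1.
by rewrite sign_mean_cross ?mulr0// eq_sym.
Qed.

(** The chain is [cosh x <= 1 / (1 - x ^+ 2) <= expR (2 * x ^+ 2)]. The first step adds
    [expR y <= 1 / (1 - y)] for [y = x] and [y = - x]; the second needs
    [(1 - x ^+ 2) * (1 + 2 * x ^+ 2) >= 1], whence the threshold [2^-1]. *)
Lemma cosh_le (x : R) : x ^+ 2 <= 2^-1 ->
  2^-1 * (expR x + expR (- x)) <= expR (2 * x ^+ 2).
Proof.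
move=> x2; have x1 : -1 < x < 1 by apply/andP; split; nra.
have e1 (y : R) : y < 1 -> expR y <= (1 - y)^-1.
  move=> y1; rewrite -[expR y]invrK lef_pV2 ?posrE ?invr_gt0 ?expR_gt0 ?subr_gt0//.
  by rewrite -expRN (le_trans _ (expR_ge1Dx _)).
have [xp xm] := andP x1.
have := e1 x xm; have := e1 (- x); rewrite ltrNl => /(_ xp) em ep.
apply: le_trans (_ : (1 - x ^+ 2)^-1 <= _).
  have -> : (1 - x ^+ 2)^-1 = 2^-1 * ((1 - x)^-1 + (1 - - x)^-1).
    by field; apply/and3P; split; apply/eqP; nra.
  by rewrite ler_wpM2l ?invr_ge0// lerD.
rewrite -[leRHS]invrK lef_pV2 ?posrE ?invr_gt0 ?expR_gt0//; last by nra.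
rewrite -div1r ler_pdivrMr ?expR_gt0//.
by have := expR_ge1Dx (2 * x ^+ 2); nra.
Qed.

(** Raise [t / p <= expR (t / p)] to the power [p]. *)
Lemma powR_le_expR p (t : R) : 0 < p -> 0 <= t -> t `^ p <= p `^ p * expR t.
Proof.
move=> p0 t0; have -> : t = p * (t / p) by rewrite mulrC divfK ?gt_eqF.
have tp0 : 0 <= t / p by rewrite divr_ge0// ltW.
rewrite powRM ?(ltW p0)// ler_wpM2l ?powR_ge0// (mulrC p) expRM.
by apply: powR_le; rewrite ?(ltW p0)// (le_trans _ (expR_ge1Dx _))// lerDr.
Qed.

Lemma sign_mean_expR n (x : 'I_n -> R) : \sum_k x k ^+ 2 <= 2^-1 ->
  sign_mean (fun s => expR (\sum_k s k * x k)) <= expR 1.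
Proof.
move=> x2; under eq_fun do rewrite expR_sum.
rewrite (sign_mean_prod (fun k t => expR (t * x k))).
apply: le_trans (_ : expR (2 * \sum_k x k ^+ 2) <= _); last by rewrite ler_expR; lra.
rewrite mulr_sumr expR_sum; apply: ler_prod => k _.
rewrite mulr_ge0 ?invr_ge0 ?addr_ge0 ?expR_ge0//= mul1r mulN1r cosh_le//.
by apply: le_trans x2; rewrite (bigD1 k)//= lerDl sumr_ge0// => j _; rewrite sqr_ge0.
Qed.

(* [|t|^p] is dominated by [exp |t|], and the mean of [exp S] is a product of
   hyperbolic cosines; scale to [\sum_k x k ^+ 2 = 1/2]. *)
Lemma khintchine_upper p : 0 < p -> exists2 c, 0 < c &
  forall n (x : 'I_n -> R),
    sign_mean (fun s => `|\sum_k s k * x k| `^ p) <= c * (\sum_k x k ^+ 2) `^ (p / 2).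
Proof.
move=> p0; pose B := p `^ p * (2 * expR 1).
have B0 : 0 < B by rewrite !mulr_gt0 ?expR_gt0// powR_gt0.
have small n (x : 'I_n -> R) : \sum_k x k ^+ 2 <= 2^-1 ->
    sign_mean (fun s => `|\sum_k s k * x k| `^ p) <= B.
  move=> x2; apply: le_trans (_ : sign_mean (fun s => p `^ p *
    (expR (\sum_k s k * x k) + expR (\sum_k - s k * x k))) <= _).
    apply: ler_sign_mean => s; apply: le_trans (powR_le_expR p0 _) _ => //.
    rewrite ler_wpM2l ?powR_ge0//.
    under [X in _ <= _ + expR X]eq_bigr do rewrite mulNr.
    rewrite sumrN; set y := \sum_k _.
    have [y0|y0] := leP 0 y; first by rewrite ger0_norm ?lerDl ?expR_ge0.
    by rewrite ltr0_norm ?lerDr ?expR_ge0.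
  rewrite sign_meanZ ler_wpM2l ?powR_ge0// sign_meanD.
  rewrite (sign_mean_opp (fun s => expR (\sum_k s k * x k))).
  by have := sign_mean_expR x2; lra.
exists (B * 2 `^ (p / 2)) => [|n x]; first by rewrite mulr_gt0// powR_gt0.
set A := \sum_k x k ^+ 2.
have A0 : 0 <= A by apply: sumr_ge0 => k _; apply: sqr_ge0.
have [Az|An] := eqVneq A 0.
  have xz k : x k = 0.
    apply/eqP; rewrite -sqrf_eq0 eq_le sqr_ge0 andbT -Az /A.
    by rewrite (bigD1 k)//= lerDl sumr_ge0// => j _; rewrite sqr_ge0.
  rewrite [leLHS](_ : _ = 0).
    by rewrite mulr_ge0 ?powR_ge0// mulr_ge0 ?powR_ge0// ltW.
  rewrite -[RHS](sign_mean_cst n); apply: eq_sign_mean => s _.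
  by rewrite big1 ?normr0 ?powR0 ?gt_eqF// => k _; rewrite xz mulr0.
have {}An : 0 < A by rewrite lt_def An.
pose d := Num.sqrt (2 * A).
have d0 : 0 < d by rewrite sqrtr_gt0 mulr_gt0.
have /small : \sum_k (x k / d) ^+ 2 <= 2^-1.
  under eq_bigr do rewrite expr_div_n.
  rewrite -mulr_suml sqr_sqrtr ?mulr_ge0// -/A.
  by rewrite invfM mulrCA divff ?mulr1// gt_eqF.
have -> : (fun s => `|\sum_k s k * (x k / d)| `^ p) =
   fun s => d `^ (- p) * `|\sum_k s k * x k| `^ p.
  apply/funext => s; under eq_bigr do rewrite mulrA.
  rewrite -mulr_suml normrM normfV (gtr0_norm d0) powRM ?invr_ge0 ?(ltW d0)//.
  by rewrite mulrC -powR_inv1 ?(ltW d0)// -powRrM mulN1r.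
rewrite sign_meanZ powRN mulrC ler_pdivrMr ?powR_gt0// => /le_trans; apply.
rewrite -[leRHS]mulrA ler_wpM2l ?(ltW B0)// /d -powR12_sqrt ?mulr_ge0//.
by rewrite -powRrM powRM// (mulrC 2^-1).
Qed.

(* For [\sum_k x k ^+ 2 = 1] and [S] the signed sum, take means in
   [S^2 <= C |S|^p + 1/4 + S^4 / L^2], where [L] is so large that the last term has
   mean at most [1/4]. *)
Lemma khintchine_lower p : 0 < p -> exists2 c, 0 < c &
  forall n (x : 'I_n -> R),
    (\sum_k x k ^+ 2) `^ (p / 2) <= c * sign_mean (fun s => `|\sum_k s k * x k| `^ p).
Proof.
move=> p0; have [B B0 HB] := khintchine_upper (ltr0Sn R 3).
pose L := Num.sqrt (4 * B + 1).
have L2 : L ^+ 2 = 4 * B + 1 by rewrite sqr_sqrtr//; lra.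
have L0 : 0 < L by rewrite sqrtr_gt0; lra.
pose C := L ^+ 2 * 2 `^ p.
have C0 : 0 < C by rewrite mulr_gt0 ?powR_gt0// exprn_gt0.
(* Three ranges: [t <= 1/2] is paid by [4^-1], [t >= L] by the quartic term, and in between
   [1 < 2 * t] and [t < L] give the term with [C]. *)
have pw (t : R) : 0 <= t -> t ^+ 2 <= C * t `^ p + 4^-1 + (L ^+ 2)^-1 * t `^ 4.
  move=> t0; rewrite powR_mulrn//.
  have T1 : 0 <= C * t `^ p by rewrite mulr_ge0 ?powR_ge0// ltW.
  have T2 : 0 <= (L ^+ 2)^-1 * t ^+ 4 by rewrite mulr_ge0 ?invr_ge0 ?exprn_ge0// ltW.
  have [t2|t2] := leP t 2^-1; first by nra.
  have [tL|tL] := leP L t.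
    suff : t ^+ 2 <= (L ^+ 2)^-1 * t ^+ 4 by lra.
    rewrite ler_pdivlMl ?exprn_gt0// (_ : t ^+ 4 = t ^+ 2 * t ^+ 2); last by ring.
    by rewrite ler_wpM2r ?sqr_ge0// ler_sqr ?nnegrE// ltW.
  suff : t ^+ 2 <= C * t `^ p by lra.
  rewrite /C -mulrA -powRM//; apply: le_trans (_ : L ^+ 2 * 1 <= _).
    by rewrite mulr1 ler_sqr ?nnegrE// ltW.
  rewrite ler_wpM2l ?sqr_ge0//.
  have := @powR_le R 1 (2 * t) p (ltW p0) ler01.
  by rewrite powR1; apply; lra.
have unit n (x : 'I_n -> R) : \sum_k x k ^+ 2 = 1 ->
    1 <= 2 * C * sign_mean (fun s => `|\sum_k s k * x k| `^ p).
  move=> x1; have := @ler_sign_mean n _ _ (fun s => pw _ (normr_ge0 (\sum_k s k * x k))).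
  rewrite !sign_meanD !sign_meanZ sign_mean_cst.
  have -> : sign_mean (fun s => `|\sum_k s k * x k| ^+ 2) = 1.
    by rewrite -x1 -sign_mean_sqr; congr sign_mean; apply/funext => s; rewrite real_normK ?num_real.
  have := HB n x; rewrite x1 powR1 mulr1 => h4.
  have : (L ^+ 2)^-1 * sign_mean (fun s => `|\sum_k s k * x k| `^ 4) <= 4^-1.
    rewrite ler_pdivrMl ?exprn_gt0//; apply: le_trans h4 _; rewrite L2; lra.
  by lra.
exists (2 * C) => [|n x]; first by rewrite mulr_gt0.
set A := \sum_k x k ^+ 2.
have A0 : 0 <= A by apply: sumr_ge0 => k _; apply: sqr_ge0.
have S0 : 0 <= sign_mean (fun s => `|\sum_k s k * x k| `^ p).
  by apply: sign_mean_ge0 => s; rewrite powR_ge0.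
have [->|An] := eqVneq A 0.
  rewrite powR0; last by rewrite gt_eqF ?divr_gt0.
  by apply: mulr_ge0 => //; apply: mulr_ge0 => //; apply: ltW.
have {}An : 0 < A by rewrite lt_def An.
pose d := Num.sqrt A.
have d0 : 0 < d by rewrite sqrtr_gt0.
have /unit : \sum_k (x k / d) ^+ 2 = 1.
  under eq_bigr do rewrite expr_div_n.
  by rewrite -mulr_suml sqr_sqrtr// -/A divff ?gt_eqF.
have -> : (fun s => `|\sum_k s k * (x k / d)| `^ p) =
   fun s => d `^ (- p) * `|\sum_k s k * x k| `^ p.
  apply/funext => s; under eq_bigr do rewrite mulrA.
  rewrite -mulr_suml normrM normfV (gtr0_norm d0) powRM ?invr_ge0 ?(ltW d0)//.
  by rewrite mulrC -powR_inv1 ?(ltW d0)// -powRrM mulN1r.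
rewrite sign_meanZ powRN mulrCA ler_pdivlMl ?powR_gt0// mulr1 => H.
by rewrite (mulrC p) powRrM powR12_sqrt.
Qed.

End khintchine.

(** * Compact open subgroups and measurability *)

HB.instance Definition _ (G : topologicalGroupType) :=
  Topological.on (pointed_group G).

Section topological_group.
Context {G : topologicalGroupType}.
Implicit Types (A U : set G) (g x y : G).

Lemma continuous_mulg g : continuous (fun x : G => (g * x)%g).
Proof.
move=> x; apply: (@continuous_comp _ _ _ (fun x : G => (g, x)) (fun z : G * G => (z.1 * z.2)%g)).
  by apply: cvg_pair; [exact: cvg_cst | exact: cvg_id].
exact: mulg_continuous.
Qed.

Lemma continuous_divg g : continuous (fun x : G => (x^-1 * g)%g).
Proof.
move=> x; apply: (@continuous_comp _ _ _ (fun x : G => ((x^-1)%g, g)) (fun z : G * G => (z.1 * z.2)%g)).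
  by apply: cvg_pair; [exact: invg_continuous | exact: cvg_cst].
exact: mulg_continuous.
Qed.

Lemma continuous_ldivg : continuous (fun z : G * G => (z.1^-1 * z.2)%g).
Proof.
move=> z; apply: (@continuous_comp _ _ _ (fun z : G * G => ((z.1^-1)%g, z.2)) (fun z : G * G => (z.1 * z.2)%g)).
  apply: cvg_pair; last exact: cvg_snd.
  apply: (@continuous_comp _ _ _ fst (fun x : G => (x^-1)%g)).
    exact: cvg_fst.
  exact: invg_continuous.
exact: mulg_continuous.
Qed.

Lemma open_measurable_borel U : open U -> measurable (U : set (borel G)).
Proof. by move=> oU; apply: sub_sigma_algebra. Qed.

Lemma continuous_measurable_borel (f : G -> G) :
  continuous f -> measurable_fun setT (f : borel G -> borel G).
Proof.
move=> cf; refine (@measurability _ _ (borel G) (borel G) setT f (@open G) _ _) => //.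
move=> _ [U oU <-]; rewrite setTI; apply: open_measurable_borel.
by apply: open_comp => // x _; apply: cf.
Qed.

Lemma measurable_mulg g : measurable_fun setT (fun x : borel G => (g * x)%g : borel G).
Proof. exact (continuous_measurable_borel (@continuous_mulg g)). Qed.

Lemma measurable_divg g : measurable_fun setT (fun x : borel G => (x^-1 * g)%g : borel G).
Proof. exact (continuous_measurable_borel (@continuous_divg g)). Qed.

(** For [x] outside [A] the whole coset [x A] avoids [A], so the complement is open. *)
Lemma open_subgroup_closed A : is_subgroup A -> open A -> closed A.
Proof.
move=> [A1 AM AV] oA; rewrite -[A]setCK; apply: open_closedC.
rewrite openE => x nAx; rewrite /interior /=.
have : nbhs x ((fun y : G => (x^-1 * y)%g) @^-1` A).
  by apply: continuous_mulg; rewrite mulVg; apply: open_nbhs_nbhs; split.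
apply: filterS => y /= Axy Ay; apply: nAx.
by have := AM _ _ Ay (AV _ Axy); rewrite invgM invgK mulVKg.
Qed.

Lemma open_coset A x : open A -> open [set y | A (x^-1 * y)%g].
Proof. by move=> oA; apply: open_comp => // y _; exact: continuous_mulg. Qed.

(** Serves twice: for a countable base of the topology, and for the positivity of the measure of
    small subgroups. *)
Lemma compact_coset_cover A U : compact A -> is_subgroup U -> open U ->
  exists s : seq G, forall x, A x -> exists2 a, a \in s & U (a^-1 * x)%g.
Proof.
move=> cA [U1 _ _] oU; move: cA; rewrite (@compact_cover (pointed_group G)).
move=> /(_ (pointed_group G) setT (fun a => [set y | U (a^-1 * y)%g])).
case=> [a _|x _|D _ DA]; first exact: open_coset.
  by exists x => //=; rewrite mulVg.
by exists (finmap.enum_fset D) => x /DA [a aD ax]; exists a.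
Qed.

End topological_group.

(** The properties of the chain of subgroups on which the averages rely. The index set is all of
    [int] and inclusions need not be strict, so that both forms of [I] are treated together. *)
Record open_filtration (R : realType) (G : topologicalGroupType)
    (mu : {measure set (borel G) -> \bar R}) (H : int -> set G) : Prop := {
  ofl_subgroup : forall k, is_subgroup (H k) ;
  ofl_open : forall k, open (H k) ;
  ofl_compact : forall k, compact (H k) ;
  ofl_fin : forall k, (mu (H k) < +oo)%E ;
  ofl_gt0 : forall k, (0 < mu (H k))%E ;
  ofl_le : forall k l, k <= l -> H l `<=` H k ;
  ofl_cover : forall x, exists k, H k x ;
  ofl_base : forall U : set G, open U -> U 1%g -> exists k, H k `<=` U }.

Section filtration.
Context {R : realType} {G : topologicalGroupType}
  {mu : {measure set (borel G) -> \bar R}} {H : int -> set G}.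
Hypothesis HH : open_filtration mu H.

(** The index [(m, k, n)] stands for the [n]-th coset of [H k] in a finite list covering [H m].
    Around a point of an open set some coset of a small [H k] fits, and it equals any listed coset
    through that point. *)
Lemma ofl_countable_base : exists B : int * int * nat -> set G,
  (forall i, open (B i)) /\
  forall U x, open U -> U x -> exists2 i, B i x & B i `<=` U.
Proof.
pose coset (a : G) k := [set x | H k (a^-1 * x)%g].
have cosetO a k : open (coset a k) by exact/open_coset/(ofl_open HH).
have /choice[F FP] : forall mk : int * int, exists s : seq G,
    forall x, H mk.1 x -> exists2 a, a \in s & coset a mk.2 x.
  move=> [m k]; apply: compact_coset_cover; first exact: ofl_compact HH m.
    exact: ofl_subgroup HH k.
  exact: ofl_open HH k.
exists (fun i => coset (nth 1%g (F i.1) i.2) i.1.2); split => // U x oU Ux.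
have [k kU] : exists k, H k `<=` [set y | U (x * y)%g].
  apply: (ofl_base HH); last by rewrite /= mulg1.
  by apply: open_comp => // y _; exact: continuous_mulg.
have [m mx] := ofl_cover HH x.
have [a aF ax] := FP (m, k) _ mx.
exists (m, k, index a (F (m, k))); rewrite /= nth_index// => y ay.
have [_ HM HV] := ofl_subgroup HH k.
rewrite -[y](mulVKg x); apply: kU.
by have := HM _ _ (HV _ ax) ay; rewrite invgM invgK -mulgA mulVKg.
Qed.

(** By second countability the preimage of an open set is a countable union of open rectangles,
    hence belongs to the product sigma-algebra. Fubini for convolution integrands rests on this. *)
Lemma continuous2_measurable_borel (f : G * G -> G) : continuous f ->
  measurable_fun setT (f : borel G * borel G -> borel G).
Proof.
move=> cf; refine (@measurability _ _ (borel G * borel G)%type (borel G) setT f (@open G) _ _) => //.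
move=> _ [U oU <-]; rewrite setTI.
have [B [oB BP]] := ofl_countable_base.
pose C (ij : (int * int * nat) * (int * int * nat)) : set (borel G * borel G) :=
  if pselect (B ij.1 `*` B ij.2 `<=` f @^-1` U) then B ij.1 `*` B ij.2 else set0.
have -> : f @^-1` U = \bigcup_ij C ij.
  rewrite eqEsubset; split => [[x y] Uxy|z [ij _]]; last first.
    by rewrite /C; case: pselect => // s /s.
  have : nbhs (x, y) (f @^-1` U) by apply: cf; apply: open_nbhs_nbhs; split.
  case=> -[V W] [/= Vx Wy] VW.
  have [i ix iV] := BP _ _ (@open_interior _ V) Vx.
  have [j jy jW] := BP _ _ (@open_interior _ W) Wy.
  have ijU : B i `*` B j `<=` f @^-1` U.
    move=> [u v] [/= /iV/interior_subset Vu /jW/interior_subset Wv].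
    exact: (VW (u, v)).
  by exists (i, j) => //; rewrite /C; case: pselect.
apply: countable_bigcupT_measurable; first exact: countableP.
move=> ij; rewrite /C; case: (pselect _) => ? /=; last exact: measurable0.
by apply: measurableX; apply: open_measurable_borel.
Qed.

Lemma measurable_ldivg :
  measurable_fun setT (fun z : borel G * borel G => (z.1^-1 * z.2)%g : borel G).
Proof. exact (continuous2_measurable_borel continuous_ldivg). Qed.

Lemma ofl_measurable k : measurable (H k : set (borel G)).
Proof. exact (open_measurable_borel (ofl_open HH k)). Qed.

Lemma ofl_sigma_finite : sigma_finite setT mu.
Proof.
exists (fun n : nat => H (- n%:Z)) => [|n]; last first.
  by split; [exact: ofl_measurable | exact: ofl_fin HH _].
rewrite eqEsubset; split => // x _; have [k kx] := ofl_cover HH x.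
exists `|k|%N => //; apply: (ofl_le HH _ kx).
by case: (intP k) => //= n; rewrite lerNr opprK.
Qed.

End filtration.

(** * Averages over compact open subgroups *)

(* A copy of [mu] on which the filtration provides a sigma-finite structure. *)
Definition ofl_measure (R : realType) (G : topologicalGroupType)
  (mu : {measure set (borel G) -> \bar R}) (H : int -> set G)
  (HH : open_filtration mu H) : set (borel G) -> \bar R := mu.

HB.instance Definition _ R G mu H (HH : @open_filtration R G mu H) :=
  Measure.on (ofl_measure HH).
HB.instance Definition _ R G mu H (HH : @open_filtration R G mu H) :=
  @Measure_isSigmaFinite.Build _ _ _ (ofl_measure HH) (ofl_sigma_finite HH).

Section averages.
Context {R : realType} {G : topologicalGroupType}
  {mu : {measure set (borel G) -> \bar R}} {H : int -> set G}.
Hypothesis HH : open_filtration mu H.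
Hypothesis mul_inv : left_invariant mu.
Local Notation gT := (borel G).
Implicit Types (f g h : gT -> R) (k l : int).

Lemma integral_mulg (g : G) (f : gT -> \bar R) :
  measurable_fun setT f -> (forall x, 0 <= f x)%E ->
  (\int[mu]_x f (g * x)%g = \int[mu]_x f x)%E.
Proof.
move=> mf f0; pose phi : gT -> gT := fun x => (g * x)%g.
have mphi : measurable_fun setT phi := measurable_mulg g.
have := ge0_integral_pushforward mphi mu measurableT mf (fun x _ => f0 x).
rewrite preimage_setT => <-; apply: eq_measure_integral => A mA _.
rewrite /pushforward -[RHS](mul_inv g^-1%g mA).
congr (mu _); rewrite eqEsubset; split => x /=.
  by move=> Ax; exists (g * x)%g => //; rewrite mulKg.
by move=> [y Ay <-]; rewrite /phi mulVKg.
Qed.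

Lemma integral_exchange (F : gT * gT -> \bar R) : measurable_fun setT F ->
  (forall z, 0 <= F z)%E ->
  (\int[mu]_x \int[mu]_y F (x, y) = \int[mu]_y \int[mu]_x F (x, y))%E.
Proof. exact: (@fubini_tonelli _ _ _ _ _ (ofl_measure HH) (ofl_measure HH)). Qed.

Lemma measurable_integral1 (F : gT * gT -> \bar R) : measurable_fun setT F ->
  (forall z, 0 <= F z)%E -> measurable_fun setT (fun y => \int[mu]_x F (x, y))%E.
Proof. exact: (@measurable_fun_fubini_tonelli_G _ _ _ _ _ (ofl_measure HH)). Qed.

Lemma measurable_conv (w f : gT -> R) :
  measurable_fun setT w -> measurable_fun setT f ->
  measurable_fun setT (fun z : gT * gT => w z.1 * f (z.1^-1 * z.2)%g).
Proof.
move=> mw mf; apply: measurable_funM.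
  by apply: measurableT_comp => //; exact: measurable_fst.
exact: (measurableT_comp mf (measurable_ldivg HH)).
Qed.

Lemma measurable_conv1 (w f : gT -> R) (s : gT) :
  measurable_fun setT w -> measurable_fun setT f ->
  measurable_fun setT (fun t : gT => w t * f (t^-1 * s)%g).
Proof.
move=> mw mf; apply: measurable_funM => //.
exact: (measurableT_comp mf (measurable_divg s)).
Qed.

(** A class closed under sums, products, positive powers and averages, on which every integral is
    finite. *)
Definition test_fun f := [/\ measurable_fun setT f, (forall x, 0 <= f x),
  (exists M, forall x, f x <= M) & exists l, forall x, ~ H l x -> f x = 0].

Definition avg k f (s : gT) : R :=
  fine (\int[mu]_t (\1_(H k : set gT) t * f (t^-1 * s)%g)%:E) / fine (mu (H k)).

(** Replaces measurability for the sigma-algebra whose atoms are the cosets [H k s]. *)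
Definition subgroup_invariant k f := forall u s, H k u -> f (u * s)%g = f s.

Lemma test_ge0 f : test_fun f -> forall x, 0 <= f x. Proof. by case. Qed.
Lemma test_measurable f : test_fun f -> measurable_fun setT f. Proof. by case. Qed.

Lemma test_EFin f : test_fun f -> measurable_fun setT (fun x => (f x)%:E).
Proof. by case=> mf _ _ _; exact/measurable_EFinP. Qed.

Lemma test_le f g : test_fun g -> measurable_fun setT f -> (forall x, 0 <= f x <= g x) ->
  test_fun f.
Proof.
move=> [mg g0 [M gM] [l gl]] mf fg; split => //.
- by move=> x; case/andP: (fg x).
- by exists M => x; case/andP: (fg x) => _ /le_trans; apply.
- exists l => x /gl gx; apply/eqP; rewrite eq_le.
  by have := fg x; rewrite gx andbC.
Qed.

Lemma test_add f g : test_fun f -> test_fun g -> test_fun (fun x => f x + g x).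
Proof.
move=> [mf f0 [M fM] [k fk]] [mg g0 [N gN] [l gl]]; split.
- exact: measurable_funD.
- by move=> x; rewrite addr_ge0.
- by exists (M + N) => x; rewrite lerD.
- exists (Num.min k l) => x nx; rewrite fk ?gl ?addr0// => hx; apply: nx;
    by apply: (ofl_le HH _ hx); rewrite ge_min lexx ?orbT.
Qed.

Lemma test_mul f g : test_fun f -> test_fun g -> test_fun (fun x => f x * g x).
Proof.
move=> [mf f0 [M fM] [k fk]] [mg g0 [N gN] [l gl]]; split.
- exact: measurable_funM.
- by move=> x; rewrite mulr_ge0.
- by exists (M * N) => x; rewrite ler_pM.
- by exists k => x /fk ->; rewrite mul0r.
Qed.

Lemma test_scale c f : 0 <= c -> test_fun f -> test_fun (fun x => c * f x).
Proof.
move=> c0 [mf f0 [M fM] [k fk]]; split.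
- by apply: measurable_funM => //; exact: measurable_cst.
- by move=> x; rewrite mulr_ge0.
- by exists (c * M) => x; rewrite ler_wpM2l.
- by exists k => x /fk ->; rewrite mulr0.
Qed.

Lemma test_zero : test_fun (fun=> 0).
Proof. by split => //; [exists 0 | exists 0]. Qed.

Lemma test_sum (I : Type) (r : seq I) (P : pred I) (f : I -> gT -> R) :
  (forall i, P i -> test_fun (f i)) -> test_fun (fun x => \sum_(i <- r | P i) f i x).
Proof.
move=> tf; elim: r => [|i r IH].
  by under eq_fun do rewrite big_nil; exact: test_zero.
under eq_fun do rewrite big_cons.
by case Pi : (P i) => //; apply: test_add => //; exact: tf.
Qed.

Lemma test_powR f p : 0 < p -> test_fun f -> test_fun (fun x => f x `^ p).
Proof.
move=> p0 [mf f0 [M fM] [k fk]]; split.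
- exact: (measurableT_comp (measurable_powR p) mf).
- by move=> x; exact: powR_ge0.
- by exists (M `^ p) => x; apply: powR_le => //; exact: ltW.
- by exists k => x /fk ->; rewrite powR0// gt_eqF.
Qed.

Lemma test_integral_lty f : test_fun f -> (\int[mu]_x (f x)%:E < +oo)%E.
Proof.
move=> [mf f0 [M fM] [k fk]].
apply: le_lt_trans (_ : \int[mu]_x (M * \1_(H k : set gT) x)%:E < +oo)%E.
  apply: ge0_le_integral => //=.
  - by move=> x _; rewrite lee_fin.
  - exact/measurable_EFinP.
  - by apply/measurable_EFinP/measurable_funM => //; apply: measurable_indic;
      exact: ofl_measurable HH k.
  - move=> x _; rewrite lee_fin indicE; have [hx|hx] := pselect (H k x).
      by rewrite mem_set// mulr1.
    by rewrite memNset// mulr0 fk.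
have M0 : 0 <= M by exact: le_trans (f0 1%g) (fM 1%g).
under eq_integral do rewrite EFinM; rewrite ge0_integralZl_EFin//; last first.
  by apply/measurable_EFinP; apply: measurable_indic; exact: ofl_measurable HH k.
rewrite integral_indic ?setIT//; last exact: ofl_measurable HH k.
by apply: lte_mul_pinfty => //; exact: ofl_fin HH k.
Qed.

Definition tint f : R := fine (\int[mu]_x (f x)%:E).

Lemma tint_EFin f : test_fun f -> ((tint f)%:E = \int[mu]_x (f x)%:E)%E.
Proof.
move=> tf; rewrite fineK// ge0_fin_numE ?test_integral_lty//.
by apply: integral_ge0 => x _; rewrite lee_fin test_ge0.
Qed.

Lemma tint_le f g : test_fun f -> test_fun g -> (forall x, f x <= g x) -> tint f <= tint g.
Proof.
move=> tf tg fg; rewrite -lee_fin !tint_EFin//; apply: ge0_le_integral => //.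
- by move=> x _; rewrite lee_fin test_ge0.
- exact: test_EFin.
- exact: test_EFin.
- by move=> x _; rewrite lee_fin fg.
Qed.

Lemma tint_ge0 f : test_fun f -> 0 <= tint f.
Proof. by move=> tf; apply/fine_ge0/integral_ge0 => x _; rewrite lee_fin test_ge0. Qed.

Lemma tint_add f g : test_fun f -> test_fun g -> tint (fun x => f x + g x) = tint f + tint g.
Proof.
move=> tf tg; apply: EFin_inj; rewrite tint_EFin ?EFinD ?tint_EFin//; last exact: test_add.
under eq_integral do rewrite EFinD; rewrite ge0_integralD//.
- by move=> x _; rewrite lee_fin test_ge0.
- exact: test_EFin.
- by move=> x _; rewrite lee_fin test_ge0.
- exact: test_EFin.
Qed.

Lemma tint_scale c f : 0 <= c -> test_fun f -> tint (fun x => c * f x) = c * tint f.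
Proof.
move=> c0 tf; apply: EFin_inj; rewrite tint_EFin ?EFinM ?tint_EFin//; last exact: test_scale.
under eq_integral do rewrite EFinM; rewrite ge0_integralZl_EFin//.
- by move=> x _; rewrite lee_fin test_ge0.
- exact: test_EFin.
Qed.

Lemma tint_sum (I : Type) (r : seq I) (f : I -> gT -> R) :
  (forall i, test_fun (f i)) -> tint (fun x => \sum_(i <- r) f i x) = \sum_(i <- r) tint (f i).
Proof.
move=> tf; elim: r => [|i r IH].
  under eq_fun do rewrite big_nil; rewrite big_nil.
  by rewrite /tint integral0.
under eq_fun do rewrite big_cons; rewrite tint_add// ?IH ?big_cons//.
exact: test_sum.
Qed.

End averages.

Section average_operators.
Context {R : realType} {G : topologicalGroupType}
  {mu : {measure set (borel G) -> \bar R}} {H : int -> set G}.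
Hypothesis HH : open_filtration mu H.
Hypothesis mul_inv : left_invariant mu.
Local Notation gT := (borel G).
Local Notation test_fun := (@test_fun R G H).
Local Notation avg := (@avg R G mu H).
Local Notation invariant := (@subgroup_invariant R G H).
Local Notation tint := (@tint R G mu).
Implicit Types (f g h : gT -> R) (k l : int).

(** Weaker than [test_fun] in order to admit constants, with which Jensen's inequality and the upper
    bound of an average are proved. *)
Definition bounded_nonneg f := [/\ measurable_fun setT f, (forall x, 0 <= f x) &
  exists M, forall x, f x <= M].

Lemma test_bounded_nonneg f : test_fun f -> bounded_nonneg f.
Proof. by case. Qed.

Lemma measurable_indicH k : measurable_fun setT (\1_(H k : set gT) : gT -> R).
Proof. by apply: measurable_indic; exact: ofl_measurable HH k. Qed.

Lemma fine_muH k : (fine (mu (H k)))%:E = mu (H k).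
Proof. by rewrite fineK// ge0_fin_numE//; exact: ofl_fin HH k. Qed.

Lemma fine_muH_gt0 k : 0 < fine (mu (H k)).
Proof. by rewrite -lte_fin fine_muH; exact: ofl_gt0 HH k. Qed.

Lemma measurable_avgE f k s : bounded_nonneg f ->
  measurable_fun setT (fun t : gT => (\1_(H k : set gT) t * f (t^-1 * s)%g)%:E).
Proof.
case=> mf _ _; apply/measurable_EFinP; apply: measurable_conv1 => //.
exact: measurable_indicH.
Qed.

Lemma avgE f k s : bounded_nonneg f ->
  ((avg k f s * fine (mu (H k)))%:E =
   \int[mu]_t (\1_(H k : set gT) t * f (t^-1 * s)%g)%:E)%E.
Proof.
move=> bf; rewrite divfK ?gt_eqF ?fine_muH_gt0// fineK// ge0_fin_numE; last first.
  by apply: integral_ge0 => t _; case: bf => _ f0 _; rewrite lee_fin mulr_ge0.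
have [_ f0 [M fM]] := bf.
have M0 : 0 <= M by exact: le_trans (f0 1%g) (fM 1%g).
apply: le_lt_trans (_ : \int[mu]_x (M * \1_(H k : set gT) x)%:E < +oo)%E.
  apply: ge0_le_integral => //.
  - by move=> t _; rewrite lee_fin mulr_ge0.
  - exact: measurable_avgE.
  - by apply/measurable_EFinP/measurable_funM => //; exact: measurable_indicH.
  - by move=> t _; rewrite lee_fin mulrC ler_wpM2r.
under eq_integral do rewrite EFinM; rewrite ge0_integralZl_EFin//; last first.
  by apply/measurable_EFinP; exact: measurable_indicH.
rewrite integral_indic ?setIT//; last exact: ofl_measurable HH k.
by apply: lte_mul_pinfty => //; exact: ofl_fin HH k.
Qed.

Lemma avg_ge0 f k s : bounded_nonneg f -> 0 <= avg k f s.
Proof.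
case=> _ f0 _; apply: divr_ge0; last exact/ltW/fine_muH_gt0.
by apply/fine_ge0/integral_ge0 => t _; rewrite lee_fin mulr_ge0.
Qed.

Lemma avg_le f g k s : bounded_nonneg f -> bounded_nonneg g ->
  (forall x, f x <= g x) -> avg k f s <= avg k g s.
Proof.
move=> bf bg fg; rewrite -(ler_pM2r (fine_muH_gt0 k)) -lee_fin !avgE//.
apply: ge0_le_integral => //.
- by move=> t _; case: bf => _ f0 _; rewrite lee_fin mulr_ge0.
- exact: measurable_avgE.
- exact: measurable_avgE.
- by move=> t _; rewrite lee_fin ler_wpM2l.
Qed.

Lemma bounded_nonneg_add f g : bounded_nonneg f -> bounded_nonneg g ->
  bounded_nonneg (fun x => f x + g x).
Proof.
move=> [mf f0 [M fM]] [mg g0 [N gN]]; split; first exact: measurable_funD.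
  by move=> x; rewrite addr_ge0.
by exists (M + N) => x; rewrite lerD.
Qed.

Lemma bounded_nonneg_scale c f : 0 <= c -> bounded_nonneg f ->
  bounded_nonneg (fun x => c * f x).
Proof.
move=> c0 [mf f0 [M fM]]; split; first exact: measurable_funM.
  by move=> x; rewrite mulr_ge0.
by exists (c * M) => x; rewrite ler_wpM2l.
Qed.

Lemma bounded_nonneg_cst c : 0 <= c -> bounded_nonneg (fun=> c).
Proof. by move=> c0; split => //; exists c. Qed.

Lemma avg_add f g k s : bounded_nonneg f -> bounded_nonneg g ->
  avg k (fun x => f x + g x) s = avg k f s + avg k g s.
Proof.
move=> bf bg; apply: (mulIf (lt0r_neq0 (fine_muH_gt0 k))); apply: EFin_inj.
rewrite mulrDl EFinD !avgE//; last exact: bounded_nonneg_add.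
under eq_integral do rewrite mulrDr EFinD; rewrite ge0_integralD//.
- by move=> t _; case: bf => _ f0 _; rewrite lee_fin mulr_ge0.
- exact: measurable_avgE.
- by move=> t _; case: bg => _ g0 _; rewrite lee_fin mulr_ge0.
- exact: measurable_avgE.
Qed.

Lemma avg_scale c f k s : 0 <= c -> bounded_nonneg f ->
  avg k (fun x => c * f x) s = c * avg k f s.
Proof.
move=> c0 bf; apply: (mulIf (lt0r_neq0 (fine_muH_gt0 k))); apply: EFin_inj.
rewrite -[in RHS]mulrA [in RHS]EFinM !avgE//; last exact: bounded_nonneg_scale.
under eq_integral do rewrite mulrCA EFinM; rewrite ge0_integralZl_EFin//.
- by move=> t _; case: bf => _ f0 _; rewrite lee_fin mulr_ge0.
- exact: measurable_avgE.
Qed.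

Lemma avg_cst c k s : 0 <= c -> avg k (fun=> c) s = c.
Proof.
move=> c0; apply: (mulIf (lt0r_neq0 (fine_muH_gt0 k))); apply: EFin_inj.
rewrite avgE; last exact: bounded_nonneg_cst.
under eq_integral do rewrite mulrC EFinM; rewrite ge0_integralZl_EFin//.
  rewrite integral_indic ?setIT//; last exact: ofl_measurable HH k.
  by rewrite EFinM fine_muH.
by apply/measurable_EFinP; exact: measurable_indicH.
Qed.

(** Jensen for the square: average [2 * c * f <= f ^+ 2 + c ^+ 2], with [c] the average of [f]. *)
Lemma avg_sqr_le f k s : bounded_nonneg f ->
  avg k f s ^+ 2 <= avg k (fun x => f x ^+ 2) s.
Proof.
move=> bf; pose c := avg k f s; have c0 : 0 <= c by exact: avg_ge0.
have bf2 : bounded_nonneg (fun x => f x ^+ 2).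
  case: bf => mf f0 [M fM]; split; first exact: measurable_funX.
    by move=> x; rewrite sqr_ge0.
  by exists (M ^+ 2) => x; rewrite ler_sqr ?nnegrE// (le_trans (f0 x)).
have : avg k (fun x => 2 * c * f x) s <= avg k (fun x => f x ^+ 2 + c ^+ 2) s.
  apply: avg_le.
  - by apply: bounded_nonneg_scale => //; lra.
  - by apply: bounded_nonneg_add => //; apply: bounded_nonneg_cst; rewrite sqr_ge0.
  - by move=> x; have := sqr_ge0 (f x - c); nra.
have -> : avg k (fun x => f x ^+ 2 + c ^+ 2) s = avg k (fun x => f x ^+ 2) s + avg k (fun=> c ^+ 2) s.
  exact: avg_add bf2 (bounded_nonneg_cst (sqr_ge0 c)).
have c20 : 0 <= 2 * c by lra.
rewrite (avg_scale k s c20 bf).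
by rewrite avg_cst ?sqr_ge0// -/c; nra.
Qed.

Lemma avg_test f k : test_fun f -> test_fun (avg k f).
Proof.
move=> tf; have bf := test_bounded_nonneg tf.
case: (tf) => mf f0 [M fM] [l fl]; split.
- apply: measurable_funM => //; apply: measurableT_comp; first exact: fine_measurable.
  apply: (@measurable_integral1 _ _ _ _ HH (fun z => (\1_(H k : set gT) z.1 * f (z.1^-1 * z.2)%g)%:E)).
    apply/measurable_EFinP; apply: (measurable_conv HH) => //.
    exact: measurable_indicH.
  by move=> z; rewrite lee_fin mulr_ge0.
- by move=> s; exact: avg_ge0.
- exists M => s; have M0 : 0 <= M by exact: le_trans (f0 1%g) (fM 1%g).
  by rewrite -[leRHS](avg_cst k s M0) avg_le//; exact: bounded_nonneg_cst.
(* If [t] is in [H k] and [t^-1 s] in [H l], both lie in the larger of the two subgroups, and so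
   does [s]. *)
- exists (Num.min k l) => s ns; rewrite /avg integral0_eq ?mul0r// => t _.
  rewrite indicE; have [Ht|Ht] := pselect (H k t); last by rewrite memNset// mul0r.
  rewrite fl ?mulr0// => Hts; apply: ns; rewrite -[s](mulVKg t).
  have [_ HM _] := ofl_subgroup HH (Num.min k l).
  apply: HM; first by apply: (ofl_le HH _ Ht); rewrite ge_min lexx.
  by apply: (ofl_le HH _ Hts); rewrite ge_min lexx orbT.
Qed.

Lemma indic_mulg k u t : H k u -> \1_(H k : set gT) (u * t)%g = \1_(H k : set gT) t :> R.
Proof.
move=> Hu; have [H1 HM HV] := ofl_subgroup HH k.
rewrite !indicE; congr (nat_of_bool _)%:R; apply/idP/idP; rewrite !inE => Ht.
  by rewrite -[t](mulKg u); apply: HM => //; apply: HV.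
exact: HM.
Qed.

(** Substitute [u * t] for [t] in the integral: [u] belongs to [H k], so the indicator does not
    change, and [u] cancels in the argument of [f]. *)
Lemma avg_invariant f k l : k <= l -> bounded_nonneg f -> invariant l (avg k f).
Proof.
move=> kl bf u s Hu; have {}Hu := ofl_le HH kl Hu.
apply: (mulIf (lt0r_neq0 (fine_muH_gt0 k))); apply: EFin_inj; rewrite !avgE//.
rewrite -(integral_mulg mul_inv u (measurable_avgE k (u * s)%g bf)); last first.
  by move=> t; case: bf => _ f0 _; rewrite lee_fin mulr_ge0.
apply: eq_integral => t _; rewrite indic_mulg// invgM -mulgA mulKg.
by [].
Qed.

(** The defining property of a conditional expectation. Up to the factor [mu (H k)], Fubini writes
    the left side as an integral over [t] in [H k] of the integral of [f s * g (t^-1 s)] in [s].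
    Left invariance turns the inner one into that of [f (t s) * g s], and [f (t s) = f s]. *)
Lemma tint_avg f g k : test_fun f -> test_fun g -> invariant k f ->
  tint (fun x => f x * avg k g x) = tint (fun x => f x * g x).
Proof.
move=> tf tg fk; have bg := test_bounded_nonneg tg.
have tag := avg_test k tg.
have [mf f0 _ _] := tf; have [mg g0 _ _] := tg.
apply: (mulIf (lt0r_neq0 (fine_muH_gt0 k))); apply: EFin_inj.
rewrite !EFinM ![((tint _)%:E * _)%E]muleC.
rewrite !(tint_EFin HH)//; [|exact: test_mul|exact: test_mul].
rewrite -ge0_integralZl_EFin//; last 2 first.
- by move=> x _; rewrite lee_fin mulr_ge0// (test_ge0 tag).
- exact (test_EFin (test_mul tf tag)).
pose F (z : gT * gT) : \bar R := (\1_(H k : set gT) z.1 * (f z.2 * g (z.1^-1 * z.2)%g))%:E.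
have mF : measurable_fun setT F.
  apply/measurable_EFinP; rewrite (_ : (fun _ => _) = fun z : gT * gT =>
    f z.2 * (\1_(H k : set gT) z.1 * g (z.1^-1 * z.2)%g)); last by apply/funext => z; rewrite mulrCA.
  apply: measurable_funM; first by apply: measurableT_comp => //; exact: measurable_snd.
  by apply: (measurable_conv HH) => //; exact: measurable_indicH.
have F0 z : (0 <= F z)%E by rewrite lee_fin !mulr_ge0.
transitivity (\int[mu]_s \int[mu]_t F (t, s))%E.
  apply: eq_integral => s _; rewrite -EFinM mulrCA [X in f s * X]mulrC EFinM avgE//.
  rewrite -ge0_integralZl_EFin//.
  - by apply: eq_integral => t _; rewrite -EFinM mulrCA.
  - by move=> t _; rewrite lee_fin mulr_ge0.
  - exact: measurable_avgE.
rewrite -(integral_exchange HH mF F0).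
have mfg : measurable_fun setT (fun x => (f x * g x)%:E).
  exact (test_EFin (test_mul tf tg)).
transitivity (\int[mu]_t ((\1_(H k : set gT) t)%:E * \int[mu]_s (f s * g s)%:E))%E; last first.
  rewrite -(tint_EFin HH (test_mul tf tg)).
  under eq_integral do rewrite muleC.
  rewrite ge0_integralZl_EFin//; last 2 first.
  - by apply/measurable_EFinP; exact: measurable_indicH.
  - exact: tint_ge0 (test_mul tf tg).
  by rewrite integral_indic ?setIT//; [rewrite fine_muH muleC | exact: ofl_measurable HH k].
apply: eq_integral => t _; rewrite -ge0_integralZl_EFin//; last first.
  by move=> s _; rewrite lee_fin mulr_ge0.
rewrite -(integral_mulg mul_inv t); last 2 first.
- exact (measurableT_comp mF (pair1_measurable t)).
- by move=> s.
apply: eq_integral => s _; rewrite /F /= mulKg -EFinM.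
have [Ht|Ht] := pselect (H k t); first by rewrite fk.
by rewrite indicE memNset// !mul0r.
Qed.

(** Both sides equal the integral of the product of the two averages, since an average over [H k] is
    invariant under [H k]. *)
Lemma tint_avg_sym f g k : test_fun f -> test_fun g ->
  tint (fun x => avg k f x * g x) = tint (fun x => f x * avg k g x).
Proof.
move=> tf tg; have taf := avg_test k tf; have tag := avg_test k tg.
rewrite -(tint_avg taf tg (avg_invariant (lexx k) (test_bounded_nonneg tf))).
under eq_fun do rewrite mulrC; under [in RHS]eq_fun do rewrite mulrC.
exact: (tint_avg tag tf (avg_invariant (lexx k) (test_bounded_nonneg tg))).
Qed.

End average_operators.

(** * Dual Doob inequality and square functions *)

Section square_functions.
Context {R : realType} {G : topologicalGroupType}
  {mu : {measure set (borel G) -> \bar R}} {H : int -> set G}.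
Hypothesis HH : open_filtration mu H.
Hypothesis mul_inv : left_invariant mu.
Local Notation gT := (borel G).
Local Notation test_fun := (@test_fun R G H).
Local Notation avg := (@avg R G mu H).
Local Notation tint := (@tint R G mu).
Implicit Types (f g h : gT -> R) (k l : int) (kappa : nat -> int).

(* [h i] below is the power [S_(i+1)^(r-1)] cut off to a large subgroup, so that it is
   a test function even when [r = 1]. *)
Lemma dual_doob r : 1 <= r -> exists2 C, 0 <= C &
  forall N kappa (F : nat -> gT -> R),
    {homo kappa : i j / (i <= j)%N >-> i <= j} -> (forall i, test_fun (F i)) ->
    tint (fun x => (\sum_(i < N) avg (kappa i) (F i) x) `^ r) <=
    C * tint (fun x => (\sum_(i < N) F i x) `^ r).
Proof.
move=> r1; have r0 : 0 < r by lra.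
have [c c0 Hc] := powR_increment_le r1.
(* This number times [c] is at most [1/2], so the term in [S N] can be absorbed on the left at the
   end. *)
have d0 : 0 < (2 * (c + 1))^-1 by rewrite invr_gt0; lra.
have [C C0 HC] := mul_powR_absorb r1 d0.
exists (2 * (c * C)) => [|N kappa F kmono tF]; first by rewrite !mulr_ge0.
pose S n (x : gT) := \sum_(i < n) avg (kappa i) (F i) x.
have tE i : test_fun (avg (kappa i) (F i)) by exact: (avg_test HH _ (tF i)).
have tS n : test_fun (S n) by apply: (test_sum HH) => i _; exact: tE.
have S0 n x : 0 <= S n x by exact: (test_ge0 (tS n)).
have Smono x : {homo S^~ x : n m / (n <= m)%N >-> n <= m}.
  apply: homo_leq => // [y z t|n]; first exact: le_trans.
  by rewrite /S big_ord_recr lerDl (test_ge0 (tE _)).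
have [_ _ [M SM] [l Sl]] := tS N.
(* [H l0] contains the support of [S N], so the cut-off loses nothing, and every [H (kappa i)], so
   the cut-off power stays invariant. *)
pose l0 := Num.min l (kappa 0%N).
pose h i (x : gT) := \1_(H l0 : set gT) x * S i.+1 x `^ (r - 1).
have th i : (i < N)%N -> test_fun (h i).
  move=> iN; have M0 : 0 <= M by exact: le_trans (S0 N 1%g) (SM 1%g).
  split.
  - apply: measurable_funM; first exact: (measurable_indicH HH).
    by apply: (measurableT_comp (measurable_powR (r - 1))); exact: test_measurable (tS _).
  - by move=> x; rewrite mulr_ge0 ?powR_ge0.
  - exists (M `^ (r - 1)) => x; apply: le_trans (_ : 1 * S i.+1 x `^ (r - 1) <= _).
      by rewrite ler_wpM2r ?powR_ge0// indicE lern1 leq_b1.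
    rewrite mul1r powR_le ?subr_ge0//; apply: le_trans (SM x).
    exact: Smono.
  - by exists l0 => x nx; rewrite /h indicE memNset ?mul0r.
have hinv i : @subgroup_invariant R G H (kappa i) (h i).
  move=> u s Hu; rewrite /h.
  have Hu0 : H l0 u.
    have l0k : l0 <= kappa i by rewrite /l0 ge_min (kmono 0%N)// orbT.
    exact: (ofl_le HH l0k).
  rewrite (indic_mulg HH s Hu0); congr (_ * _ `^ _); apply: eq_bigr => j _.
  apply: (avg_invariant HH mul_inv _ (test_bounded_nonneg (tF j))) Hu.
  by apply: kmono; rewrite -ltnS.
have tSr : test_fun (fun x => S N x `^ r) by exact: test_powR.
have tFr : test_fun (fun x => (\sum_(i < N) F i x) `^ r).
  by apply: test_powR => //; exact: (test_sum HH).
(* Telescoping by [powR_increment_le]: the increment of [S] at step [i] is the [i]-th average. Where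
   that average is nonzero, [x] lies in the support of [S N] and the indicator inside [h] equals
   [1]. *)
have tel n x : (n <= N)%N ->
    S n x `^ r <= \sum_(i < n) c * (avg (kappa i) (F i) x * h i x).
  elim: n => [|n IH] nN; first by rewrite /S !big_ord0 powR0 ?gt_eqF.
  rewrite big_ord_recr /=; have := Hc (S n x) (S n.+1 x) (S0 _ _) (Smono x _ _ (leqnSn n)).
  move=> /le_trans; apply; apply: lerD; first exact/IH/ltnW.
  rewrite {1}/S big_ord_recr /= -/(S n x) addrAC subrr add0r.
  rewrite ler_wpM2l//.
  have [->|E0] := eqVneq (avg (kappa n) (F n) x) 0; first by rewrite !mul0r.
  rewrite ler_wpM2l ?(test_ge0 (tE n))// /h.
  suff Hx : H l0 x by rewrite indicE mem_set// mul1r.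
  have [Hx|/Sl SN0] := pselect (H l x).
    by apply: (ofl_le HH _ Hx); rewrite /l0 ge_min lexx.
  move/eqP: E0; case; apply/eqP; rewrite eq_le (test_ge0 (tE n)) andbT -SN0.
  by apply: le_trans (Smono x _ _ nN); rewrite /S big_ord_recr /= lerDr; exact: S0.
have tEh i : (i < N)%N -> test_fun (fun x => avg (kappa i) (F i) x * h i x).
  by move=> iN; apply: test_mul (tE i) (th i iN).
have tFh i : (i < N)%N -> test_fun (fun x => F i x * h i x).
  by move=> iN; apply: test_mul (tF i) (th i iN).
have step1 : tint (fun x => S N x `^ r) <=
    c * tint (fun x => \sum_(i < N) F i x * h i x).
  apply: le_trans (_ : tint (fun x => \sum_(i < N) c * (avg (kappa i) (F i) x * h i x)) <= _).
    apply: (tint_le HH) => // [|x]; last exact: tel.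
    by apply: (test_sum HH) => i _; apply: test_scale => //; exact: tEh.
  rewrite (tint_sum HH) => [|i]; last by apply: test_scale => //; exact: tEh.
  rewrite (tint_sum HH) => [|i]; last exact: tFh.
  rewrite mulr_sumr; apply: ler_sum => i _.
  rewrite (tint_scale HH _ (tEh i (ltn_ord i)))// ler_wpM2l//.
  under eq_fun do rewrite mulrC; under [in leRHS]eq_fun do rewrite mulrC.
  by rewrite (tint_avg HH mul_inv (th i (ltn_ord i)) (tF i) (hinv i)).
have step2 : tint (fun x => \sum_(i < N) F i x * h i x) <=
   tint (fun x => C * (\sum_(i < N) F i x) `^ r + (2 * (c + 1))^-1 * S N x `^ r).
  apply: (tint_le HH).
  - by apply: (test_sum HH) => i _; exact: tFh.
  - by apply: (test_add HH) => //; apply: test_scale => //; exact: ltW.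
  move=> x; apply: le_trans (HC _ _ _ (S0 N x)); last first.
    by apply: sumr_ge0 => i _; exact: test_ge0.
  rewrite mulr_suml; apply: ler_sum => i _; rewrite ler_wpM2l ?(test_ge0 (tF i))//.
  rewrite /h; apply: le_trans (_ : 1 * S i.+1 x `^ (r - 1) <= _).
    by rewrite ler_wpM2r ?powR_ge0// indicE lern1 leq_b1.
  by rewrite mul1r powR_le ?subr_ge0//; exact: Smono.
have tSr' : test_fun (fun x => (2 * (c + 1))^-1 * S N x `^ r).
  by apply: test_scale => //; exact: ltW.
move: step2; rewrite (tint_add HH (test_scale C0 tFr) tSr').
rewrite (tint_scale HH C0 tFr) (tint_scale HH (ltW d0) tSr).
set X := tint (fun x => S N x `^ r) in step1 *.
set Y := tint (fun x => (\sum_(i < N) F i x) `^ r).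
set Z := tint _ in step1 *.
have X0 : 0 <= X by exact: (tint_ge0 tSr).
move=> ZX; have cZ := ler_wpM2l c0 ZX.
have : c * ((2 * (c + 1))^-1 * X) <= 2^-1 * X.
  rewrite mulrA ler_wpM2r// invfM mulrCA ler_piMr//.
  by rewrite ler_pdivrMr; lra.
rewrite mulrDr in cZ; rewrite -/X.
by nra.
Qed.

Definition avg_comb (kappa : nat -> int) (a : nat -> R) (N : nat) f (x : gT) : R :=
  \sum_(i < N) a i * avg (kappa i) f x.

Lemma avg_comb_test kappa a N f : (forall i, 0 <= a i) -> test_fun f ->
  test_fun (avg_comb kappa a N f).
Proof.
move=> a0 tf; apply: (test_sum HH) => i _; apply: test_scale => //.
exact: (avg_test HH _ tf).
Qed.

Lemma tint_avg_comb_sym kappa a N f g : (forall i, 0 <= a i) -> test_fun f -> test_fun g ->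
  tint (fun x => avg_comb kappa a N f x * g x) = tint (fun x => f x * avg_comb kappa a N g x).
Proof.
move=> a0 tf tg.
have E1 x : avg_comb kappa a N f x * g x = \sum_(i < N) a i * (avg (kappa i) f x * g x).
  by rewrite /avg_comb mulr_suml; apply: eq_bigr => i _; rewrite -[LHS]mulrA.
have E2 x : f x * avg_comb kappa a N g x = \sum_(i < N) a i * (f x * avg (kappa i) g x).
  by rewrite /avg_comb mulr_sumr; apply: eq_bigr => i _; rewrite mulrCA.
under eq_fun do rewrite E1; under [in RHS]eq_fun do rewrite E2.
have t1 i : test_fun (fun x => avg (kappa i) f x * g x).
  by apply: test_mul => //; exact: (avg_test HH _ tf).
have t2 i : test_fun (fun x => f x * avg (kappa i) g x).
  by apply: test_mul => //; exact: (avg_test HH _ tg).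
rewrite (tint_sum HH) => [|i]; last exact: test_scale.
rewrite (tint_sum HH) => [|i]; last exact: test_scale.
apply: eq_bigr => i _; rewrite (tint_scale HH (a0 i) (t1 i)) (tint_scale HH (a0 i) (t2 i)).
by rewrite (tint_avg_sym HH mul_inv (kappa i) tf tg).
Qed.

Lemma test_sum_sqr n (f : 'I_n -> gT -> R) : (forall j, test_fun (f j)) ->
  test_fun (fun x => \sum_j f j x ^+ 2).
Proof.
move=> tf; apply: (test_sum HH) => j _; under eq_fun do rewrite expr2.
exact: test_mul.
Qed.

Lemma avg_sum (I : Type) (r : seq I) (f : I -> gT -> R) k s : (forall i, test_fun (f i)) ->
  avg k (fun x => \sum_(i <- r) f i x) s = \sum_(i <- r) avg k (f i) s.
Proof.
move=> tf; elim: r => [|i r IH].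
  under eq_fun do rewrite big_nil; rewrite big_nil.
  exact: (avg_cst HH k s (lexx 0)).
under eq_fun do rewrite big_cons; rewrite big_cons -IH.
apply: (avg_add HH k s (test_bounded_nonneg (tf i))).
by apply/test_bounded_nonneg/(test_sum HH).
Qed.

Lemma square_function_ge2 p c : 2 <= p -> 0 <= c -> exists2 C, 0 <= C &
  forall n N kappa (a : 'I_n -> nat -> R) (f : 'I_n -> gT -> R),
    {homo kappa : i j / (i <= j)%N >-> i <= j} -> (forall j i, 0 <= a j i) ->
    (forall j, \sum_(i < N) a j i <= c) -> (forall j, test_fun (f j)) ->
    tint (fun x => (\sum_j avg_comb kappa (a j) N (f j) x ^+ 2) `^ (p / 2)) <=
    C * tint (fun x => (\sum_j f j x ^+ 2) `^ (p / 2)).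
Proof.
move=> p2 c0; have r1 : 1 <= p / 2 by lra.
have r0 : 0 < p / 2 by lra.
have [D D0 HD] := dual_doob r1.
(* One power of [c] comes from Cauchy-Schwarz with the weights [a j], the other from bounding
   [\sum_i F i] by the sum of squares; [D] is the dual Doob constant. *)
exists (c `^ (p / 2) * D * c `^ (p / 2)) => [|n N kappa a f kmono a0 ac tf].
  by rewrite !mulr_ge0 ?powR_ge0.
pose F i (x : gT) := \sum_j a j i * f j x ^+ 2.
have tf2 j : test_fun (fun x => f j x ^+ 2).
  by under eq_fun do rewrite expr2; exact: test_mul.
have tF i : test_fun (F i) by apply: (test_sum HH) => j _; exact: test_scale.
have tS : test_fun (fun x => \sum_(i < N) avg (kappa i) (F i) x).
  by apply: (test_sum HH) => i _; exact: (avg_test HH _ (tF i)).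
have tFF : test_fun (fun x => \sum_(i < N) F i x) by exact: (test_sum HH).
have tA : test_fun (fun x => \sum_j avg_comb kappa (a j) N (f j) x ^+ 2).
  by apply: test_sum_sqr => j; exact: avg_comb_test.
have tB := test_sum_sqr tf.
have pw x : \sum_j avg_comb kappa (a j) N (f j) x ^+ 2 <=
    c * \sum_(i < N) avg (kappa i) (F i) x.
  have -> : \sum_(i < N) avg (kappa i) (F i) x =
      \sum_j \sum_(i < N) a j i * avg (kappa i) (fun y => f j y ^+ 2) x.
    rewrite exchange_big; apply: eq_bigr => i _.
    rewrite avg_sum => [|j]; last exact: test_scale.
    apply: eq_bigr => j _.
    exact: (avg_scale HH _ _ (a0 j i) (test_bounded_nonneg (tf2 j))).
  rewrite mulr_sumr; apply: ler_sum => j _.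
  have := @sumr_CauchySchwarz _ _ (index_enum 'I_N) predT (a j)
    (fun=> 1) (fun i => avg (kappa i) (f j) x) (fun i _ => a0 j i).
  under eq_bigr do rewrite mul1r; move=> /le_trans; apply.
  under eq_bigr do rewrite expr1n mulr1.
  apply: ler_pM => //.
  - by apply: sumr_ge0.
  - by apply: sumr_ge0 => i _; rewrite mulr_ge0 ?sqr_ge0.
  apply: ler_sum => i _; rewrite ler_wpM2l//.
  exact: (avg_sqr_le HH _ _ (test_bounded_nonneg (tf j))).
have pw2 x : \sum_(i < N) F i x <= c * \sum_j f j x ^+ 2.
  rewrite /F exchange_big mulr_sumr; apply: ler_sum => j _.
  by rewrite -mulr_suml ler_wpM2r ?sqr_ge0.
apply: le_trans (_ : tint (fun x => c `^ (p / 2) * (\sum_(i < N) avg (kappa i) (F i) x) `^ (p / 2)) <= _).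
  apply: (tint_le HH) => [||x].
  - exact: test_powR.
  - by apply: test_scale; [exact: powR_ge0 | exact: test_powR].
  rewrite -powRM//; last exact: (test_ge0 tS).
  by apply: powR_le; [exact: ltW | exact: (test_ge0 tA) | exact: pw].
rewrite (tint_scale HH (powR_ge0 _ _) (test_powR r0 tS)) -!mulrA ler_wpM2l ?powR_ge0//.
apply: le_trans (HD N kappa F kmono tF) _; rewrite ler_wpM2l//.
rewrite -(tint_scale HH (powR_ge0 _ _) (test_powR r0 tB)).
apply: (tint_le HH) => [||x].
- exact: test_powR.
- by apply: test_scale; [exact: powR_ge0 | exact: test_powR].
rewrite -powRM//; last exact: (test_ge0 tB).
by apply: powR_le; [exact: ltW | exact: (test_ge0 tFF) | exact: pw2].
Qed.

(* Test [S^2 = \sum_j (A_j f_j)^2] against [g_j = A_j f_j S^(p-2)], for which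
   [\sum_j A_j f_j g_j = S^p] and [(\sum_j g_j^2)^(q/2) = S^p], and apply the case
   [q >= 2] to the [g_j]. *)
Lemma square_function_lt2 p c : 1 < p -> p < 2 -> 0 <= c -> exists2 C, 0 <= C &
  forall n N kappa (a : 'I_n -> nat -> R) (f : 'I_n -> gT -> R),
    {homo kappa : i j / (i <= j)%N >-> i <= j} -> (forall j i, 0 <= a j i) ->
    (forall j, \sum_(i < N) a j i <= c) -> (forall j, test_fun (f j)) ->
    tint (fun x => (\sum_j avg_comb kappa (a j) N (f j) x ^+ 2) `^ (p / 2)) <=
    C * tint (fun x => (\sum_j f j x ^+ 2) `^ (p / 2)).
Proof.
move=> p1 p2 c0; pose q := p / (p - 1).
have p0 : 0 < p by lra.
have q2 : 2 <= q by rewrite ler_pdivlMr; lra.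
have q0 : 0 < q by lra.
have pq : p^-1 + q^-1 = 1 by rewrite /q; field; apply/andP; split; apply/eqP; lra.
have [D D0 HD] := square_function_ge2 q2 c0.
(* As in [dual_doob]: [D] times this number is at most [1/2], so the dual term is absorbed. *)
have d0 : 0 < (2 * (D + 1))^-1 by rewrite invr_gt0; lra.
have [C C0 HC] := sum_mul_absorb p0 q0 pq d0.
exists (2 * C) => [|n N kappa a f kmono a0 ac tf]; first by rewrite mulr_ge0.
have r0 : 0 < p / 2 by lra.
have arith (X Y Z W : R) : 0 <= X -> X = W ->
    W <= C * Y + (2 * (D + 1))^-1 * Z -> Z <= D * X -> X <= 2 * C * Y.
  move=> X0 <- XY ZX; have : (2 * (D + 1))^-1 * Z <= 2^-1 * X.
    apply: le_trans (_ : (2 * (D + 1))^-1 * (D * X) <= _).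
      by rewrite ler_wpM2l// ltW.
    by rewrite mulrA ler_wpM2r// invfM -mulrA ler_piMr// mulrC ler_pdivrMr; lra.
  by move: (_ * Z) XY => t; lra.
pose A j := avg_comb kappa (a j) N (f j).
(* [S] is the sum of squares itself, so the power [p - 2] of its root becomes [p / 2 - 1]. This
   exponent is negative, and [g j] is recognized as a test function through the bound
   [S ^ ((p - 1) / 2)]. *)
pose S (x : gT) := \sum_j A j x ^+ 2.
have tA j : test_fun (A j) by exact: avg_comb_test.
have tS : test_fun S by exact: test_sum_sqr.
have S0 x : 0 <= S x by exact: (test_ge0 tS).
pose g j (x : gT) := A j x * S x `^ (p / 2 - 1).
have AS j x : A j x <= S x `^ 2^-1.
  rewrite powR12_sqrt// -(ger0_norm (test_ge0 (tA j) x)) -sqrtr_sqr ler_wsqrtr//.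
  by rewrite /S (bigD1 j)//= lerDl sumr_ge0// => i _; rewrite sqr_ge0.
have tg j : test_fun (g j).
  apply: (test_le (g := fun x => S x `^ ((p - 1) / 2))).
  - by apply: test_powR => //; lra.
  - apply: measurable_funM; first exact: test_measurable (tA j).
    by apply: (measurableT_comp (measurable_powR _)); exact: test_measurable tS.
  move=> x; rewrite mulr_ge0 ?powR_ge0 ?(test_ge0 (tA j))//=.
  have -> : (p - 1) / 2 = 2^-1 + (p / 2 - 1) by lra.
  rewrite powRD; last by apply/implyP => /eqP; lra.
  by rewrite ler_wpM2r ?powR_ge0.
have gS x : (\sum_j g j x ^+ 2) `^ (q / 2) = S x `^ (p / 2).
  have -> : \sum_j g j x ^+ 2 = S x `^ (p - 1).
    rewrite /g; under eq_bigr do rewrite exprMn.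
    have p10 : 0 < p - 1 by lra.
    rewrite -mulr_suml -/(S x) -[in RHS](mulr_powRB1 (S0 x) p10).
    rewrite -powR_mulrn ?powR_ge0// -powRrM; congr (_ * _ `^ _); lra.
  by rewrite -powRrM; congr (_ `^ _); rewrite /q; field; apply/eqP; lra.
have AgS x : \sum_j A j x * g j x = S x `^ (p / 2).
  rewrite -(mulr_powRB1 (S0 x) r0) /S mulr_suml.
  by apply: eq_bigr => j _; rewrite /g mulrA -expr2.
have tSp : test_fun (fun x => S x `^ (p / 2)) by exact: test_powR.
have tf2 := test_sum_sqr tf.
have tfp : test_fun (fun x => (\sum_j f j x ^+ 2) `^ (p / 2)) by exact: test_powR.
pose B j := avg_comb kappa (a j) N (g j).
have tB j : test_fun (B j) by exact: avg_comb_test.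
have tBp : test_fun (fun x => (\sum_j B j x ^+ 2) `^ (q / 2)).
  by apply: test_powR; [lra | exact: test_sum_sqr].
have step1 : tint (fun x => S x `^ (p / 2)) = tint (fun x => \sum_j f j x * B j x).
  under eq_fun do rewrite -AgS.
  rewrite (tint_sum HH) => [|j]; last exact: test_mul.
  rewrite (tint_sum HH) => [|j]; last exact: test_mul.
  by apply: eq_bigr => j _; exact: tint_avg_comb_sym.
have step2 : tint (fun x => \sum_j f j x * B j x) <=
    C * tint (fun x => (\sum_j f j x ^+ 2) `^ (p / 2)) +
    (2 * (D + 1))^-1 * tint (fun x => (\sum_j B j x ^+ 2) `^ (q / 2)).
  rewrite -(tint_scale HH C0 tfp) -(tint_scale HH (ltW d0) tBp).
  rewrite -(tint_add HH (test_scale C0 tfp) (test_scale (ltW d0) tBp)).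
  apply: (tint_le HH) => [||x]; last exact: HC.
  - by apply: (test_sum HH) => j _; exact: test_mul.
  - by apply: (test_add HH); apply: test_scale => //; exact: ltW.
have := HD n N kappa a g kmono a0 ac tg.
under [in X in _ <= X -> _]eq_fun do rewrite gS.
rewrite -/B.
have X0 : 0 <= tint (fun x => S x `^ (p / 2)) by exact: (tint_ge0 tSp).
move=> ZX; exact: (arith _ _ _ _ X0 step1 step2 ZX).
Qed.

Lemma square_function p c : 1 < p -> 0 <= c -> exists2 C, 0 <= C &
  forall n N kappa (a : 'I_n -> nat -> R) (f : 'I_n -> gT -> R),
    {homo kappa : i j / (i <= j)%N >-> i <= j} -> (forall j i, 0 <= a j i) ->
    (forall j, \sum_(i < N) a j i <= c) -> (forall j, test_fun (f j)) ->
    tint (fun x => (\sum_j avg_comb kappa (a j) N (f j) x ^+ 2) `^ (p / 2)) <=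
    C * tint (fun x => (\sum_j f j x ^+ 2) `^ (p / 2)).
Proof.
move=> p1 c0; have [p2|p2] := leP 2 p; first exact: square_function_ge2.
exact: square_function_lt2.
Qed.

End square_functions.

(** * Kernels dominated on annuli *)

(** Fatou in the form suited to truncations: at almost every point [g] is eventually dominated by
    the sequence, hence is below its lower limit. *)
Lemma fatou_le d (T : measurableType d) (R : realType) (mu : {measure set T -> \bar R})
    (f : nat -> T -> \bar R) (g : T -> \bar R) (B : \bar R) :
  (forall n, measurable_fun setT (f n)) -> (forall n x, 0 <= f n x)%E ->
  measurable_fun setT g -> (forall x, 0 <= g x)%E ->
  {ae mu, forall x, exists m, forall n, (m <= n)%N -> (g x <= f n x)%E} ->
  (forall n, \int[mu]_x f n x <= B)%E -> (\int[mu]_x g x <= B)%E.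
Proof.
move=> mf f0 mg g0 gf fB.
have L (u : (\bar R)^nat) : limn_einf u = limn (einfs u) by rewrite limn_einf_lim.
apply: le_trans (_ : \int[mu]_x limn_einf (f^~ x) <= _)%E.
  apply: ae_ge0_le_integral => //.
  - move=> x _; rewrite L; apply: lime_ge; first exact: is_cvg_einfs.
    by apply: nearW => n; apply: le_ereal_inf_tmp => _ [k _ <-].
  - rewrite /limn_einf; apply: measurableT_comp => //.
    by apply: measurable_fun_limn_esup => n; apply: measurableT_comp.
  apply: filterS gf => x [m gm] _; rewrite L.
  apply: lime_ge; first exact: is_cvg_einfs.
  near=> n; apply: le_ereal_inf_tmp => _ [k /= nk <-]; apply: gm.
  by apply: leq_trans nk; near: n; exact: nbhs_infty_ge.
apply: le_trans (fatou mu measurableT mf (fun n x _ => f0 n x)) _.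
rewrite L; apply: lime_le; first exact: is_cvg_einfs.
apply: nearW => n; apply: le_trans (fB n); apply: ereal_inf_lbound.
by exists n => //=.
Unshelve. all: by end_near.
Qed.

Section dominated_kernels.
Context {R : realType} {G : topologicalGroupType}
  {mu : {measure set (borel G) -> \bar R}} {H : int -> set G}.
Hypothesis HH : open_filtration mu H.
Hypothesis mul_inv : left_invariant mu.
Local Notation gT := (borel G).
Local Notation test_fun := (@test_fun R G H).
Local Notation tint := (@tint R G mu).
Local Notation avg_comb := (@avg_comb R G mu H).
Implicit Types (f g h w : gT -> R) (k l : int).

Definition filtration_annulus k : set gT := H k `\` H (k + 1).

(** Lists the window [-n, ..., n] increasingly by [i = 0, ..., 2 n]; hence the [n.*2.+1] terms in
    the sums below. *)
Definition shift_index (n i : nat) : int := i%:Z - n%:Z.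

Definition coeff (b : int -> R) (n i : nat) : R :=
  b (shift_index n i) * fine (mu (H (shift_index n i))).

(** Summability of the weights [b k * mu (H k)] is demanded on symmetric windows, which keeps all
    sums finite. *)
Record annulus_bound (w : gT -> R) (b : int -> R) (c : R) : Prop := {
  ab_measurable : measurable_fun setT w ;
  ab_ge0 : forall t, 0 <= w t ;
  ab_b_ge0 : forall k, 0 <= b k ;
  ab_le : forall k, {ae mu, forall t, filtration_annulus k t -> w t <= b k} ;
  ab_sum : forall n, \sum_(i < n.*2.+1) coeff b n i <= c }.

(** The bounds [b k] say nothing outside the annuli, so no mass may sit there. *)
Hypothesis ann_ae : {ae mu, forall t : gT, exists k, filtration_annulus k t}.

Definition wconv (w f : gT -> R) (s : gT) : \bar R :=
  (\int[mu]_t (w t * f (t^-1 * s)%g)%:E)%E.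

(** Truncates height and support at once. At each point the value is that of [f] from some [n] on,
    so limits are attained at a finite stage. *)
Definition cutoff (f : gT -> R) (n : nat) (x : gT) : R :=
  Num.min (f x) n%:R * \1_(H (- n%:Z) : set gT) x.

Lemma cutoff_test f n : measurable_fun setT f -> (forall x, 0 <= f x) ->
  test_fun (cutoff f n).
Proof.
move=> mf f0; split.
- apply: measurable_funM; last exact: (measurable_indicH HH).
  exact: measurable_minr.
- by move=> x; rewrite mulr_ge0// le_min f0 ler0n.
- exists n%:R => x; rewrite /cutoff indicE; case: (x \in _).
    by rewrite mulr1 ge_min lexx orbT.
  by rewrite mulr0.
- by exists (- n%:Z) => x nx; rewrite /cutoff indicE memNset// mulr0.
Qed.

Lemma cutoff_le f n x : (forall x, 0 <= f x) -> cutoff f n x <= f x.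
Proof.
move=> f0; rewrite /cutoff indicE; case: (x \in _).
  by rewrite mulr1 ge_min lexx.
by rewrite mulr0.
Qed.

Lemma cutoff_homo f x n m : (forall x, 0 <= f x) -> (n <= m)%N ->
  cutoff f n x <= cutoff f m x.
Proof.
move=> f0 nm; rewrite /cutoff; apply: ler_pM => //.
- by rewrite le_min f0 ler0n.
- by rewrite le_min ge_min lexx ge_min ler_nat nm orbT.
rewrite !indicE ler_nat; case xn : (x \in H (- n%:Z)) => //.
rewrite mem_set//; move/set_mem: xn => xn.
have mn : - m%:Z <= - n%:Z by lia.
exact: (ofl_le HH mn).
Qed.

Lemma cutoff_near f x : exists m, forall n, (m <= n)%N -> cutoff f n x = f x.
Proof.
have [k kx] := ofl_cover HH x.
exists (maxn `|k|%N (Num.truncn (f x)).+1) => n; rewrite geq_max => /andP[kn fn].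
rewrite /cutoff indicE mem_set; last first.
  have nk : - n%:Z <= k by lia.
  exact: (ofl_le HH nk).
rewrite mulr1; apply/min_idPl/ltW; apply: lt_le_trans (truncnS_gt _) _.
by rewrite ler_nat.
Qed.

(** [ex_minnP] yields the first index of the window at which [t] has left the filtration; the
    annulus is the one just before. *)
Lemma annulus_between n t : H (- n%:Z) t -> ~ H (n.+1%:Z) t ->
  exists2 i, (i < n.*2.+1)%N & filtration_annulus (shift_index n i) t.
Proof.
move=> Hn nH; pose P i := `[< ~ H (shift_index n i) t >].
have exP : exists i, P i.
  exists (n.*2.+1); apply/asboolP; rewrite /shift_index.
  by have -> : n.*2.+1%:Z - n%:Z = n.+1%:Z by lia.
case: (ex_minnP exP) => -[|i] /asboolP Pi imin.
  by case: Pi; rewrite /shift_index sub0r.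
exists i.
  apply: imin; apply/asboolP; rewrite /shift_index.
  by have -> : n.*2.+1%:Z - n%:Z = n.+1%:Z by lia.
split; last first.
  move: Pi; rewrite /shift_index.
  by have -> : i.+1%:Z - n%:Z = i%:Z - n%:Z + 1 by lia.
apply: contrapT => nHi; have : P i by apply/asboolP.
by move=> /imin; rewrite ltnn.
Qed.

Definition trunc_kernel (w : gT -> R) (n : nat) (t : gT) : R :=
  w t * \1_((H (- n%:Z) : set gT) `\` H n.+1%:Z) t.

Lemma measurable_trunc_kernel w n : measurable_fun setT w ->
  measurable_fun setT (trunc_kernel w n).
Proof.
move=> mw; apply: measurable_funM => //; apply: measurable_indic.
by apply: measurableD; exact: (ofl_measurable HH).
Qed.

(** The domination by averages on a finite window: on the annulus of index [k i] the kernel is at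
    most [b (k i)], and that annulus lies in [H (k i)]. *)
Lemma wconv_trunc_le w b c f n s : annulus_bound w b c ->
  measurable_fun setT f -> (forall x, 0 <= f x) ->
  (\int[mu]_t (trunc_kernel w n t * cutoff f n (t^-1 * s)%g)%:E <=
   (avg_comb (shift_index n) (coeff b n) n.*2.+1 (cutoff f n) s)%:E)%E.
Proof.
move=> ab mf f0; have [mw w0 b0 wb _] := ab.
have tf := cutoff_test n mf f0; have bf := test_bounded_nonneg tf.
have cf0 x : 0 <= cutoff f n x by exact: (test_ge0 tf).
pose k i := shift_index n i.
have -> : (avg_comb (shift_index n) (coeff b n) n.*2.+1 (cutoff f n) s)%:E =
    (\sum_(i < n.*2.+1) \int[mu]_t ((b (k i))%:E *
      (\1_(H (k i) : set gT) t * cutoff f n (t^-1 * s)%g)%:E))%E.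
  rewrite -sumEFin; apply: eq_bigr => i _.
  rewrite ge0_integralZl_EFin//; last 2 first.
  - by move=> t _; rewrite lee_fin mulr_ge0.
  - exact: (measurable_avgE HH).
  rewrite -(avgE HH (k i) s bf) -EFinM /coeff -/(k i); congr (_%:E).
  by rewrite -[LHS]mulrA [X in _ * X = _]mulrC.
rewrite -ge0_integral_sum//; last 2 first.
- by move=> i; apply: measurable_funeM; exact: (measurable_avgE HH).
- by move=> i t _; rewrite mule_ge0// lee_fin// mulr_ge0.
apply: ae_ge0_le_integral => //.
- by move=> t _; rewrite lee_fin mulr_ge0// mulr_ge0.
- apply/measurable_EFinP; apply: measurable_conv1; first exact: measurable_trunc_kernel.
  exact: (test_measurable tf).
- by move=> t _; apply: sume_ge0 => i _; rewrite mule_ge0// lee_fin// mulr_ge0.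
- apply: emeasurable_sum => i; apply: measurable_funeM.
  exact: (measurable_avgE HH).
have {}wb : {ae mu, forall t, forall i, filtration_annulus (k i) t -> w t <= b (k i)}.
  by apply/ae_foralln => i; exact: wb.
apply: filterS wb => t wb _.
under eq_bigr do rewrite -EFinM; rewrite sumEFin lee_fin.
have sum0 : 0 <= \sum_(i < n.*2.+1) b (k i) * (\1_(H (k i) : set gT) t * cutoff f n (t^-1 * s)%g).
  by apply: sumr_ge0 => i _; rewrite mulr_ge0// mulr_ge0.
rewrite /trunc_kernel indicE; case tn : (t \in _); last by rewrite mulr0 mul0r.
move/set_mem: tn => -[Ht nHt]; rewrite mulr1.
have [i iN it] := annulus_between Ht nHt.
rewrite (bigD1 (Ordinal iN))//=; apply: le_trans (_ : b (k i) *
  (\1_(H (k i) : set gT) t * cutoff f n (t^-1 * s)%g) <= _).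
  by rewrite indicE mem_set ?mul1r; [rewrite ler_wpM2r//; exact: wb | case: it].
by rewrite lerDl sumr_ge0// => j _; rewrite mulr_ge0// mulr_ge0.
Qed.

(** If the bound failed for arbitrarily large [n], monotonicity of the truncated integrals would
    keep all of them below [v], and Fatou would contradict the strict inequality. *)
Lemma wconv_near w b c f s (v : R) : annulus_bound w b c ->
  measurable_fun setT f -> (forall x, 0 <= f x) ->
  (v%:E < wconv w f s)%E ->
  exists m, forall n, (m <= n)%N ->
    v <= avg_comb (shift_index n) (coeff b n) n.*2.+1 (cutoff f n) s.
Proof.
move=> ab mf f0 vU; apply: contrapT => /forallNP nex.
have [mw w0 _ _ _] := ab.
have mk n : measurable_fun setT (fun t => (trunc_kernel w n t * cutoff f n (t^-1 * s)%g)%:E).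
  apply/measurable_EFinP; apply: measurable_conv1; first exact: measurable_trunc_kernel.
  exact: test_measurable (cutoff_test n mf f0).
have cf0 n x : 0 <= cutoff f n x by exact: (test_ge0 (cutoff_test n mf f0)).
have k0 n t : 0 <= trunc_kernel w n t by rewrite mulr_ge0.
suff : (wconv w f s <= v%:E)%E by rewrite leNgt vU.
apply: (fatou_le mk) => //.
- by move=> n x; rewrite lee_fin mulr_ge0.
- by apply/measurable_EFinP; exact: measurable_conv1.
- by move=> x; rewrite lee_fin mulr_ge0.
- apply: filterS ann_ae => t [k [kt nkt]].
  have [m fm] := cutoff_near f (t^-1 * s)%g.
  exists (maxn m `|k|%N) => n; rewrite geq_max => /andP[mn kn].
  rewrite fm// /trunc_kernel indicE mem_set ?mulr1//; split.
    have nk : - n%:Z <= k by lia.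
    exact: (ofl_le HH nk).
  have nk : k + 1 <= n.+1%:Z by lia.
  by move=> Hn; apply: nkt; exact: (ofl_le HH nk).
move=> n; have /existsNP[m /not_implyP[nm /negP]] := nex n.
rewrite -ltNge => /ltW Av.
apply: le_trans (_ : (avg_comb (shift_index m) (coeff b m) m.*2.+1 (cutoff f m) s)%:E <= _)%E; last by rewrite lee_fin.
apply: le_trans (wconv_trunc_le m s ab mf f0).
apply: ge0_le_integral => //.
- by move=> x _; rewrite lee_fin mulr_ge0.
move=> t _; rewrite lee_fin ler_pM//; last exact: cutoff_homo.
rewrite /trunc_kernel ler_wpM2l// !indicE ler_nat.
case tn : (t \in _) => //; rewrite mem_set//; move/set_mem: tn => -[Ht nHt].
have mn1 : - m%:Z <= - n%:Z by lia.
have mn2 : n.+1%:Z <= m.+1%:Z by lia.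
split; first exact: (ofl_le HH mn1).
by move=> Hm; apply: nHt; exact: (ofl_le HH mn2).
Qed.

(** The finite minorant [v] stands in for [wconv], which may be infinite. *)
Lemma square_convolution p c : 1 < p -> 0 <= c -> exists2 C, 0 <= C &
  forall n (w : 'I_n -> gT -> R) (b : 'I_n -> int -> R) (f v : 'I_n -> gT -> R),
    (forall j, annulus_bound (w j) (b j) c) ->
    (forall j, measurable_fun setT (f j)) -> (forall j x, 0 <= f j x) ->
    (forall j, measurable_fun setT (v j)) -> (forall j x, 0 <= v j x) ->
    (forall j s, ((v j s)%:E <= wconv (w j) (f j) s)%E) ->
    (\int[mu]_s ((\sum_j v j s ^+ 2) `^ (p / 2))%:E <=
     C%:E * \int[mu]_s ((\sum_j f j s ^+ 2) `^ (p / 2))%:E)%E.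
Proof.
move=> p1 c0; have [C C0 HC] := square_function HH mul_inv p1 c0.
have r0 : 0 < p / 2 by lra.
exists (2 `^ p * C) => [|n w b f v ab mf f0 mv v0 vU]; first by rewrite mulr_ge0 ?powR_ge0.
pose A m (s : gT) := (\sum_j avg_comb (shift_index m) (coeff (b j) m) m.*2.+1
   (cutoff (f j) m) s ^+ 2) `^ (p / 2).
have tcf j m : test_fun (cutoff (f j) m) by exact: cutoff_test.
have co0 j m i : 0 <= coeff (b j) m i.
  by rewrite mulr_ge0 ?(ab_b_ge0 (ab j))// fine_ge0.
have tA m : test_fun (A m).
  apply: test_powR => //; apply: (test_sum_sqr HH) => j.
  exact: (avg_comb_test HH).
have tB m : test_fun (fun x => (\sum_j cutoff (f j) m x ^+ 2) `^ (p / 2)).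
  by apply: test_powR => //; exact: (test_sum_sqr HH).
have mpow (g : 'I_n -> gT -> R) : (forall j, measurable_fun setT (g j)) ->
    measurable_fun setT (fun s => ((\sum_j g j s ^+ 2) `^ (p / 2))%:E).
  move=> mg; apply/measurable_EFinP.
  apply: (measurableT_comp (measurable_powR (p / 2))).
  by apply: measurable_sum => j; exact: measurable_funX.
have sq0 (g : 'I_n -> gT -> R) s : 0 <= \sum_j g j s ^+ 2.
  by apply: sumr_ge0 => j _; exact: sqr_ge0.
have key : (\int[mu]_s (((2 `^ p)^-1 * (\sum_j v j s ^+ 2) `^ (p / 2))%:E) <=
    C%:E * \int[mu]_s ((\sum_j f j s ^+ 2) `^ (p / 2))%:E)%E.
  apply: (@fatou_le _ _ _ mu (fun m s => (A m s)%:E)).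
  - by move=> m; exact: (test_EFin (tA m)).
  - by move=> m s; rewrite lee_fin (test_ge0 (tA m)).
  - under eq_fun do rewrite EFinM; apply: measurable_funeM.
    exact: mpow.
  - by move=> s; rewrite lee_fin mulr_ge0 ?invr_ge0 ?powR_ge0.
  - apply: aeW => /= s.
    (* Halving [v] makes the inequality strict wherever [v] is positive, as [wconv_near] requires;
       this costs the factor [2 ^ p]. *)
    have vnear (j : 'I_n) : exists m, forall k : nat, (m <= k)%N -> v j s / 2 <=
        avg_comb (shift_index k) (coeff (b j) k) k.*2.+1 (cutoff (f j) k) s.
      have [v0s|v0s] := eqVneq (v j s) 0.
        exists 0%N => k _; rewrite v0s mul0r.
        exact: (test_ge0 (avg_comb_test HH _ _ (co0 j k) (tcf j k))).
      apply: (wconv_near (ab j) (mf j) (f0 j)).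
      apply: lt_le_trans (vU j s); rewrite lte_fin.
      by have := v0 j s; rewrite le_eqVlt eq_sym (negbTE v0s)/=; lra.
    have [m Hm] := choice vnear.
    exists (\max_j m j)%N => k mk; rewrite lee_fin.
    have -> : 2 `^ p = (2 ^+ 2) `^ (p / 2) :> R.
      by rewrite -powR_mulrn// -powRrM; congr (_ `^ _); field.
    rewrite -powR_inv1 ?powR_ge0// powRAC powR_inv1 ?exprn_ge0//.
    rewrite -powRM ?invr_ge0 ?exprn_ge0//; apply: powR_le; first exact: ltW.
      by rewrite mulr_ge0 ?invr_ge0 ?exprn_ge0.
    rewrite mulr_sumr; apply: ler_sum => j _.
    rewrite -exprVn -exprMn ler_sqr ?nnegrE ?mulr_ge0 ?invr_ge0//.
      rewrite mulrC; apply: Hm; apply: leq_trans mk; exact: leq_bigmax.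
    exact: (test_ge0 (avg_comb_test HH _ _ (co0 j k) (tcf j k))).
  move=> m; rewrite -(tint_EFin HH (tA m)).
  apply: (@le_trans _ _ (C%:E * (tint (fun x => (\sum_j cutoff (f j) m x ^+ 2) `^ (p / 2)))%:E)%E).
    rewrite -EFinM lee_fin; apply: HC => // [i i' ii'|j].
      by rewrite /shift_index; lia.
    exact: (ab_sum (ab j)).
  rewrite (tint_EFin HH (tB m)) lee_wpmul2l//; apply: ge0_le_integral => //.
  - by move=> s _; rewrite lee_fin powR_ge0.
  - exact: (test_EFin (tB m)).
  - exact: mpow.
  move=> s _; rewrite lee_fin; apply: powR_le; [exact: ltW|exact: (sq0 (fun j => cutoff (f j) m))|apply: ler_sum => j _].
  by rewrite ler_sqr ?nnegrE// ?(test_ge0 (tcf j m))//; exact: cutoff_le.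
move: key; under eq_integral do rewrite EFinM.
rewrite ge0_integralZl_EFin ?invr_ge0 ?powR_ge0//; last 2 first.
- by move=> s _; rewrite lee_fin powR_ge0.
- exact: mpow.
by rewrite EFinM -muleA lee_pdivrMl// ?powR_gt0.
Qed.

End dominated_kernels.

(** * The filtration of a Spector-Vilenkin group *)

(* The integral of a nonnegative function is its lower integral, measurable or not. *)
Lemma le_lower_integral d (T : measurableType d) (R : realType)
    (mu : {measure set T -> \bar R}) (f g : T -> \bar R) :
  (forall x, 0 <= f x)%E -> (forall x, f x <= g x)%E ->
  (\int[mu]_x f x <= \int[mu]_x g x)%E.
Proof.
move=> f0 fg; have g0 x : (0 <= g x)%E by exact: le_trans (f0 x) (fg x).
rewrite !ge0_integralTE//; apply: ereal_sup_le => _ [h hf <-].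
by exists h => // x; exact: le_trans (hf x) (fg x).
Qed.

Lemma measurable_normc d (T : measurableType d) (R : realType) (f : T -> R[i]) :
  cmeasurable f -> measurable_fun setT (fun x => ComplexField.Normc.normc (f x)).
Proof.
move=> [mRe mIm].
have -> : (fun x => ComplexField.Normc.normc (f x)) =
    fun x => (complex.Re (f x) ^+ 2 + complex.Im (f x) ^+ 2) `^ 2^-1.
  by apply/funext => x; case: (f x) => a b; rewrite powR12_sqrt// addr_ge0 ?sqr_ge0.
apply: (measurableT_comp (measurable_powR _)).
by apply: measurable_funD; exact: measurable_funX.
Qed.

Section spector_vilenkin_filtration.
Context {R : realType} {G : topologicalGroupType} {I : set int}
  {Gk : int -> set G} {mu : {measure set (borel G) -> \bar R}}.
Hypothesis sv : spector_vilenkin I Gk.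
Hypothesis I_cases : I = [set: int] \/ I = [set k | 0 <= k].
Hypothesis haar : left_haar mu.
Hypothesis mu1 : mu (Gk 0) = 1%E.
Local Notation gT := (borel G).

(* When [I] is the set of nonnegative integers, [Gk 0] is the whole group; using it at
   the negative indices gives a two-sided filtration with empty annuli there. *)
Definition sv_filtration (k : int) : set G := Gk (if `[< I k >] then k else 0).
Local Notation H := sv_filtration.

Lemma sv_index_ge0 k : 0 <= k -> I k.
Proof. by case: I_cases => ->. Qed.

Lemma sv_index_succ k : I k -> I (k + 1).
Proof. by case: I_cases => -> //= k0; rewrite addr_ge0. Qed.

Lemma sv_index_lt0 k : ~ I k -> k < 0.
Proof. by case: I_cases => -> //= /negP; rewrite -ltNge. Qed.

Lemma sv_filtrationE k : I k -> H k = Gk k.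
Proof. by move=> Ik; rewrite /H asboolT. Qed.

Lemma sv_filtration_out k : ~ I k -> H k = Gk 0.
Proof. by move=> Ik; rewrite /H asboolF. Qed.

Let idx k : I (if `[< I k >] then k else 0).
Proof. by case: asboolP => // _; exact: sv_index_ge0. Qed.

Lemma sv_le k l : I k -> I l -> k <= l -> Gk l `<=` Gk k.
Proof.
move=> Ik Il; rewrite le_eqVlt => /predU1P[->//|kl].
by case: (sv_decr sv Ik Il kl).
Qed.

Lemma sv_filtration_le k l : k <= l -> H l `<=` H k.
Proof.
move=> kl; apply: sv_le => //; case: asboolP => Ik; case: asboolP => // nIl.
- by exfalso; apply: nIl; case: I_cases Ik => -> //=; lia.
- by case: I_cases Ik nIl => -> //= /(_ Logic.I).
Qed.

(** Compactness: otherwise the sets [Gk n] minus [U] generate a proper filter on [Gk 0]. They are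
    closed, so all contain its cluster point, which must then be the identity, a point of [U]. *)
Lemma sv_filtration_base U : open U -> U 1%g -> exists k, H k `<=` U.
Proof.
move=> oU U1; apply: contrapT => /forallNP nU.
have nU' n : exists x, (Gk n%:Z `\` U) x.
  have /nonsubset[x Hx] := nU n%:Z; exists x; move: Hx.
  by rewrite sv_filtrationE//; exact: sv_index_ge0.
pose F := filter_from [set: nat] (fun n => Gk n%:Z `\` U).
have FF : ProperFilter F.
  apply: filter_from_proper => [|n _]; last exact: nU'.
  apply: filter_from_filter => [|n m _ _]; first by exists 0%N.
  exists (maxn n m) => // x [Gx nUx]; split; split => //;
    by apply: (sv_le _ _ _ Gx); rewrite ?lez_nat ?leq_maxl ?leq_maxr//; exact: sv_index_ge0.
have FG0 : F (Gk 0) by exists 0%N => // x [].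
have I0 : I 0 by exact: sv_index_ge0.
have [x [G0x clx]] := sv_compact sv I0 FF FG0.
have xn n : (Gk n%:Z `\` U) x.
  have In : I n%:Z by exact: sv_index_ge0.
  have : closed (Gk n%:Z `\` U).
    apply: closedI; last exact: open_closedC.
    exact: (open_subgroup_closed (sv_subgroup sv In) (sv_open sv In)).
  apply => V Vx; apply: clx => //; by exists n.
have x1 : x = 1%g.
  suff : [set 1%g] x by [].
  rewrite -(sv_bigcap sv) => k Ik; have [kx _] := xn `|k|%N.
  by apply: (sv_le Ik _ _ kx); [exact: sv_index_ge0 | lia].
by have [_] := xn 0%N; rewrite x1.
Qed.

Lemma sv_filtration_subgroup k : is_subgroup (H k).
Proof. exact: (sv_subgroup sv (idx k)). Qed.

Lemma sv_filtration_open k : open (H k).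
Proof. exact: (sv_open sv (idx k)). Qed.

Lemma sv_filtration_compact k : compact (H k).
Proof. exact: (sv_compact sv (idx k)). Qed.

Let mul_inv : left_invariant mu. Proof. by case: haar. Qed.

Lemma coset_measure (a : G) (A : set gT) : measurable A ->
  mu [set y | A (a^-1 * y)%g] = mu A.
Proof.
move=> mA; rewrite -(mul_inv a mA); congr (mu _).
rewrite eqEsubset; split => y /=; first by exists (a^-1 * y)%g => //; rewrite mulVKg.
by move=> [x Ax <-]; rewrite mulKg.
Qed.

Lemma sv_filtration_fin k : (mu (H k) < +oo)%E.
Proof. by case: haar => -[+ _ _] _ _; apply; exact: sv_filtration_compact. Qed.

(** Finitely many translates of [H k] cover [Gk 0], which has measure [1]. *)
Lemma sv_filtration_gt0 k : (0 < mu (H k))%E.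
Proof.
have mH j : measurable (H j : set gT) by apply: open_measurable_borel; exact: sv_filtration_open.
have H0 : H 0 = Gk 0 by rewrite sv_filtrationE//; exact: sv_index_ge0.
rewrite lt0e measure_ge0 andbT; apply/eqP => Hk0.
have [s sP] := compact_coset_cover (@sv_filtration_compact 0)
  (sv_filtration_subgroup k) (sv_filtration_open k).
have : mu.-negligible (H 0 : set gT).
  apply: (@negligibleS _ _ _ mu [set x | exists2 a, a \in s & H k (a^-1 * x)%g]) => //.
  elim: s {sP} => [|a s IH].
    apply: negligibleS (negligible_set0 mu) => x [a]; by rewrite in_nil.
  apply: (@negligibleS _ _ _ mu ([set y | H k (a^-1 * y)%g] `|`
      [set x | exists2 a, a \in s & H k (a^-1 * x)%g])).
    move=> x [b]; rewrite in_cons => /predU1P[->|bs] Hx; first by left.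
    by right; exists b.
  apply: negligibleU => //; exists [set y | H k (a^-1 * y)%g]; split => //.
    by apply: open_measurable_borel; apply: open_coset; exact: sv_filtration_open.
  by rewrite -[RHS]Hk0; exact: (coset_measure a (mH k)).
move/negligibleP => /(_ (mH 0)); rewrite H0 => G0.
by have := mu1; rewrite G0 => /eqP; rewrite eqe eq_sym oner_eq0.
Qed.

Lemma sv_filtration_cover x : exists k, H k x.
Proof.
have : [set: G] x by []; rewrite -(sv_bigcup sv) => -[k Ik kx].
by exists k; rewrite sv_filtrationE.
Qed.

Lemma sv_open_filtration : open_filtration mu H.
Proof.
split; [exact: sv_filtration_subgroup | exact: sv_filtration_open |
  exact: sv_filtration_compact | exact: sv_filtration_fin | exact: sv_filtration_gt0 |
  exact: sv_filtration_le | exact: sv_filtration_cover | exact: sv_filtration_base].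
Qed.

Local Notation annulus := (@filtration_annulus G H).

Let mH k : measurable (H k : set gT).
Proof. exact: (ofl_measurable sv_open_filtration). Qed.

Let m_ann k : measurable (annulus k).
Proof. exact: measurableD. Qed.

Lemma sv_annulus_split k : (mu (H k) = mu (annulus k) + mu (H (k + 1)))%E.
Proof.
have Hle : H (k + 1) `<=` H k by apply: sv_filtration_le; lia.
have -> : (H k : set gT) = annulus k `|` H (k + 1).
  by rewrite /filtration_annulus setUC setDUK.
rewrite measureU//; last by rewrite /filtration_annulus setDE -setIA setICl setI0.
Qed.

(** Strictness of the chain gives a point [a] of the annulus, and the coset [a H (k + 1)] stays
    inside the annulus. *)
Lemma sv_annulus_ge k : I k -> (mu (H (k + 1)) <= mu (annulus k))%E.
Proof.
move=> Ik; have Ik1 := sv_index_succ Ik.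
have kk1 : k < k + 1 by lia.
have [_ /nonsubset[a [ka nka]]] := sv_decr sv Ik Ik1 kk1.
have Hle : H (k + 1) `<=` H k by apply: sv_filtration_le; lia.
rewrite -(coset_measure a (mH (k + 1))); apply: le_measure; rewrite ?inE//.
  by apply: open_measurable_borel; apply: open_coset; exact: sv_filtration_open.
have [_ HM HV] := sv_filtration_subgroup k.
have [_ HM1 HV1] := sv_filtration_subgroup (k + 1).
move=> y /= Hy; rewrite -sv_filtrationE// in ka; split.
  by rewrite -[y](mulVKg a); apply: HM => //; exact: Hle.
move=> Hy1; apply: nka; rewrite -sv_filtrationE//.
by have := HM1 _ _ Hy1 (HV1 _ Hy); rewrite invgM invgK mulVKg.
Qed.

Lemma sv_annulus_measure k : I k -> (mu (H k) <= 2%:E * mu (annulus k))%E.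
Proof.
move=> Ik; rewrite sv_annulus_split (_ : 2%:E = 1 + 1)%E; last by rewrite -EFinD.
by rewrite ge0_muleDl// mul1e leeD2l// sv_annulus_ge.
Qed.

Lemma sv_annulus_gt0 k : I k -> (0 < mu (annulus k))%E.
Proof.
move=> Ik; rewrite lt0e measure_ge0 andbT; apply/eqP => A0.
by have := sv_annulus_measure Ik; rewrite A0 mule0 leNgt sv_filtration_gt0.
Qed.

Lemma sv_annulus_exists t : t != 1%g -> exists2 k, I k & annulus k t.
Proof.
move=> /eqP t1; have [m] := sv_filtration_cover t => Hm.
have [l Ilt] : exists2 l, I l & ~ Gk l t.
  apply: contrapT => nl; apply: t1; suff : [set 1%g] t by [].
  rewrite -(sv_bigcap sv) => k Ik; apply: contrapT => nk; by apply: nl; exists k.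
rewrite -sv_filtrationE// => nHl.
pose n := maxn `|m|%N `|l|%N.
have H1 : H (- n%:Z) t by apply: (@sv_filtration_le _ m) => //; rewrite /n; lia.
have H2 : ~ H n.+1%:Z t.
  by move=> Hn; apply: nHl; apply: (@sv_filtration_le _ n.+1%:Z) => //; rewrite /n; lia.
have [i _ it] := annulus_between H1 H2; exists (shift_index n i) => //.
(* The index found belongs to [I]: elsewhere the filtration is constant and its annuli are empty. *)
apply: contrapT => nI; case: it; rewrite sv_filtration_out// => Gt.
case; have := sv_index_lt0 nI => k0.
have [Ik|Ik] := pselect (I (shift_index n i + 1)); last by rewrite sv_filtration_out.
rewrite sv_filtrationE//; apply: (@sv_le _ 0) => //; first exact: sv_index_ge0.
by lia.
Qed.

Lemma sv_point_measurable : measurable [set 1%g : gT].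
Proof.
have -> : [set 1%g : gT] = \bigcap_n (H n%:Z).
  rewrite eqEsubset; split => [_ -> n _|x Hx].
    by have [] := sv_filtration_subgroup n%:Z.
  apply: contrapT => /eqP/sv_annulus_exists[k Ik [_]]; apply.
  have kn : k + 1 <= (absz (k + 1))%:Z by lia.
  exact: (sv_filtration_le kn (Hx _ Logic.I)).
by apply: bigcapT_measurable => n; exact: mH.
Qed.

(** Each annulus of nonnegative index has at least the mass of the next subgroup, hence at least the
    mass [c] of the identity. Iterating, [H 0] would have mass at least [n * c] for every [n], while
    its mass is [1]. *)
Lemma sv_point_null : mu [set 1%g : gT] = 0%E.
Proof.
have m1 := sv_point_measurable.
have le1 k : (mu [set 1%g : gT] <= mu (H k))%E.
  apply: le_measure; rewrite ?inE// => _ ->.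
  by have [] := sv_filtration_subgroup k.
have fin1 : mu [set 1%g : gT] \is a fin_num.
  by rewrite ge0_fin_numE// (le_lt_trans (le1 0)) ?sv_filtration_fin.
have [c cE] : exists c : R, mu [set 1%g : gT] = c%:E by exists (fine (mu [set 1%g : gT])); rewrite fineK.
rewrite cE in le1 *.
have many n k : 0 <= k -> ((n.+1%:R * c)%:E <= mu (H k))%E.
  elim: n k => [|n IH] k k0; first by rewrite mul1r.
  have k10 : 0 <= k + 1 by lia.
  rewrite sv_annulus_split -natr1 mulrDl mul1r addrC EFinD leeD// ?IH//.
  by apply: le_trans (sv_annulus_ge (sv_index_ge0 k0)); exact: le1.
have c0 : 0 <= c by rewrite -lee_fin -cE.
apply/eqP; rewrite eqe eq_le c0 andbT leNgt; apply/negP => cgt0.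
have H01 : mu (H 0) = 1%E.
  by rewrite -mu1 sv_filtrationE//; exact: sv_index_ge0.
have := many (Num.truncn c^-1) 0 (lexx _).
rewrite [X in (_ <= X)%E]H01 lee_fin leNgt => /negP; apply.
by rewrite -ltr_pdivrMr// div1r truncnS_gt.
Qed.

Lemma sv_annulus_ae : {ae mu, forall t : gT, exists k, annulus k t}.
Proof.
exists [set 1%g : gT]; split; [exact: sv_point_measurable|exact: sv_point_null|].
move=> t /= nk; apply: contrapT => /eqP/sv_annulus_exists[k _ kt].
by apply: nk; exists k.
Qed.

Lemma sv_annulus_out k : ~ I k -> annulus k = set0.
Proof.
move=> Ik; rewrite -subset0 => t [kt []]; move: kt; rewrite sv_filtration_out//.
have k0 := sv_index_lt0 Ik.
have [Ik1|Ik1] := pselect (I (k + 1)); last by rewrite sv_filtration_out.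
rewrite sv_filtrationE//; apply: sv_le => //; first exact: sv_index_ge0.
by lia.
Qed.

Lemma sv_annulus_inj k l t : annulus k t -> annulus l t -> k = l.
Proof.
move=> [kt nkt] [lt nlt]; apply/eqP; rewrite eq_le; apply/andP; split; rewrite leNgt.
  apply/negP => lk; apply: nlt; apply: sv_filtration_le kt; lia.
by apply/negP => kl; apply: nkt; apply: sv_filtration_le lt; lia.
Qed.

Local Notation abs := (sv_abs mu I Gk).

Lemma sv_abs_annulus k s : I k -> annulus k s -> abs s = mu (Gk k).
Proof.
move=> Ik ks; apply: sv_absE => //; first exact: sv_index_succ.
by rewrite -!sv_filtrationE//; exact: sv_index_succ.
Qed.

(** * From the radial majorant of a kernel to bounds on annuli *)

Variables (C0 : R) (K : gT -> R[i]).
Hypothesis KC : kernels mu I Gk C0 K.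
Local Notation rm := (radial_majorant mu I Gk K).
Let w (t : gT) : R := ComplexField.Normc.normc (K t).

Let w0 t : 0 <= w t.
Proof. by rewrite /w; case: (K t) => a b; rewrite sqrtr_ge0. Qed.

Let w_ae s : {ae mu, forall r : gT, (abs s <= abs r)%E -> ((w r)%:E <= rm s)%E}.
Proof.
have := @ess_sup_ge _ _ _ mu (fun r : gT =>
    if (abs s <= abs r)%E then modulus (K : gT -> R[i]) r else -oo%E).
by apply: filterS => r + sr; rewrite sr.
Qed.

Let w_ann k s : I k -> annulus k s ->
  {ae mu, forall r : gT, annulus k r -> ((w r)%:E <= rm s)%E}.
Proof.
move=> Ik ks; have := w_ae s; apply: filterS => r + kr; apply.
by rewrite !(sv_abs_annulus Ik)//.
Qed.

Let ann_nonempty k : I k -> exists s, annulus k s.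
Proof.
move=> Ik; apply: contrapT => /forallNP nk; have := sv_annulus_gt0 Ik.
rewrite (_ : annulus k = set0) ?measure0 ?ltxx//.
by rewrite -subset0 => x /nk.
Qed.

(** The default value [-oo] could make the essential supremum negative; an annulus of positive
    measure on which the condition on [r] holds excludes this. For the identity, where [abs s = 0],
    any annulus will do. *)
Let rm_ge0 s : (0 <= rm s)%E.
Proof.
have ex k : I k -> {ae mu, forall r : gT, annulus k r -> ((w r)%:E <= rm s)%E} -> (0 <= rm s)%E.
  move=> Ik [N [mN N0 HN]]; have [r [kr nNr]] : exists r, annulus k r /\ ~ N r.
    apply: contrapT => /forallNP nr; have := sv_annulus_gt0 Ik.
    rewrite ltNge => /negP; apply; rewrite -N0; apply: le_measure; rewrite ?inE//.
    by move=> r kr; apply: contrapT => nNr; apply: (nr r).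
  apply: (@le_trans _ _ (w r)%:E); first by rewrite lee_fin.
  by apply: contrapT => nle; apply: nNr; apply: HN => /=; apply/not_implyP; split.
have [s1|s1] := eqVneq s 1%g.
  apply: (ex 0); first exact: sv_index_ge0.
  have := w_ae s; apply: filterS => r + _; apply.
  by rewrite /sv_abs s1 eqxx; case: ifP => // _; exact: measure_ge0.
have [k Ik ks] := sv_annulus_exists s1.
exact: (ex k Ik (w_ann Ik ks)).
Qed.

(** The majorant depends on [s] only through [abs s], so its value at any point of the annulus
    serves. The value [0] off [I] goes with an empty annulus. *)
Definition annulus_majorant (k : int) : R :=
  if pselect (I k) then fine (rm (xget 1%g (annulus k))) else 0.

Let rm_const k s : I k -> annulus k s -> rm s = rm (xget 1%g (annulus k)).
Proof.
move=> Ik ks; have kx : annulus k (xget 1%g (annulus k)) by apply: xgetPex; exists s.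
rewrite /radial_majorant; congr (ess_sup _ _); apply/funext => r.
by rewrite (sv_abs_annulus Ik ks) (sv_abs_annulus Ik kx).
Qed.

(** An infinite value would be taken on a whole annulus, a set of positive measure, and make the
    integral of [rm] infinite. *)
Let rm_fin k s : I k -> annulus k s -> rm s \is a fin_num.
Proof.
move=> Ik ks; rewrite ge0_fin_numE// ltNge leye_eq; apply/negP => /eqP rmy.
have [_ intK] := KC; move: intK; apply/negP; rewrite -ltNge.
apply: (@lt_le_trans _ _ +oo%E); first exact: ltry.
have -> : (+oo = \int[mu]_(t in annulus k) (+oo : \bar R))%E.
  by rewrite integral_cst// gt0_mulye// sv_annulus_gt0.
rewrite integral_mkcond; apply: le_lower_integral => t.
  by rewrite patchE; case: ifP.
rewrite patchE; case: ifP => [/set_mem kt|_]; last exact: rm_ge0.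
by rewrite (rm_const Ik kt) -(rm_const Ik ks) rmy.
Qed.

Let rmE k s : I k -> annulus k s -> rm s = (annulus_majorant k)%:E.
Proof.
move=> Ik ks; rewrite /annulus_majorant; case: pselect => //= _.
by rewrite -(rm_const Ik ks) fineK// (rm_fin Ik ks).
Qed.

(** The majorant is constant on annuli, so its integral bounds the sum of its values weighted by the
    measures of the annuli; replacing annuli by the subgroups at most doubles that sum. *)
Lemma kernel_annulus_bound : @annulus_bound R G mu H w annulus_majorant (2 * C0).
Proof.
have maj0 k : 0 <= annulus_majorant k.
  rewrite /annulus_majorant; case: pselect => //= Ik.
  exact: fine_ge0.
split => //.
- by apply: measurable_normc; have [[]] := KC.
- move=> k; have [Ik|Ik] := pselect (I k); last first.
    by apply: aeW => t; rewrite sv_annulus_out.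
  have [s ks] := ann_nonempty Ik.
  have := w_ann Ik ks; apply: filterS => t + kt => /(_ kt).
  by rewrite (rmE Ik ks) lee_fin.
move=> n; pose k i := shift_index n i.
have kinj i j : k i = k j -> i = j by rewrite /k /shift_index => kij; lia.
have fann j : (fine (mu (annulus j)))%:E = mu (annulus j).
  rewrite fineK// ge0_fin_numE// (le_lt_trans _ (sv_filtration_fin j))//.
  by rewrite le_measure ?inE// => t [].
have step : \sum_(i < n.*2.+1) annulus_majorant (k i) * fine (mu (annulus (k i))) <= C0.
  rewrite -lee_fin; have [_] := KC; apply: le_trans; rewrite -sumEFin.
  have -> : (\sum_(i < n.*2.+1) (annulus_majorant (k i) * fine (mu (annulus (k i))))%:E =
      \int[mu]_t (\sum_(i < n.*2.+1) (annulus_majorant (k i) * \1_(annulus (k i)) t)%:E))%E.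
    rewrite ge0_integral_sum//; last 2 first.
    - by move=> i; apply/measurable_EFinP/measurable_funM => //.
    - by move=> i t _; rewrite lee_fin mulr_ge0.
    apply: eq_bigr => i _; rewrite EFinM fann -{1}(setIT (annulus _)).
    rewrite -integral_indic// -ge0_integralZl_EFin//.
    by apply/measurable_EFinP; exact: measurable_indic.
  apply: le_lower_integral => t.
    by apply: sume_ge0 => i _; rewrite lee_fin mulr_ge0.
  have [[i it]|nit] := pselect (exists i : 'I_(n.*2.+1), annulus (k i) t); last first.
    rewrite big1 ?rm_ge0// => i _; rewrite indicE memNset ?mulr0// => it.
    by apply: nit; exists i.
  rewrite (bigD1 i)//= big1 => [|j ji].
    rewrite indicE mem_set// mulr1 adde0.
    have [Ik|Ik] := pselect (I (k i)); first by rewrite (rmE Ik it).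
    by move: it; rewrite sv_annulus_out.
  rewrite indicE memNset ?mulr0// => jt; move/eqP: ji; apply; apply: val_inj.
  exact/kinj/(sv_annulus_inj jt it).
apply: le_trans (_ : 2 * \sum_(i < n.*2.+1) annulus_majorant (k i) * fine (mu (annulus (k i))) <= _); last by rewrite ler_wpM2l.
rewrite mulr_sumr; apply: ler_sum => i _; rewrite /coeff -/(k i) mulrCA.
have [Ik|Ik] := pselect (I (k i)); last first.
  by rewrite /annulus_majorant; case: pselect => //= _; rewrite !mul0r.
rewrite ler_wpM2l// -lee_fin EFinM fann (fine_muH sv_open_filtration).
exact: sv_annulus_measure.
Qed.

End spector_vilenkin_filtration.

(** * Convolution operators *)

Local Notation normc := ComplexField.Normc.normc.

Section complex_modulus.
Context {R : realType}.
Implicit Types z : R[i].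

Lemma normc_ge0 z : 0 <= normc z.
Proof. by case: z => a b; rewrite sqrtr_ge0. Qed.

Lemma normc_sqr z : normc z ^+ 2 = complex.Re z ^+ 2 + complex.Im z ^+ 2.
Proof. by case: z => a b; rewrite sqr_sqrtr// addr_ge0 ?sqr_ge0. Qed.

Lemma normc_Re z : `|complex.Re z| <= normc z.
Proof.
rewrite -ler_sqr ?nnegrE ?normc_ge0// normc_sqr real_normK ?num_real//.
by rewrite lerDl sqr_ge0.
Qed.

Lemma normc_Im z : `|complex.Im z| <= normc z.
Proof.
rewrite -ler_sqr ?nnegrE ?normc_ge0// normc_sqr real_normK ?num_real//.
by rewrite lerDr sqr_ge0.
Qed.

Lemma normc_le_ReIm z : normc z <= `|complex.Re z| + `|complex.Im z|.
Proof.
rewrite -ler_sqr ?nnegrE ?normc_ge0 ?addr_ge0// normc_sqr sqrrD.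
rewrite !real_normK ?num_real// addrAC lerDl mulrn_wge0// mulr_ge0//.
Qed.

Lemma Re_mulc (x y : R[i]) :
  complex.Re (x * y) = complex.Re x * complex.Re y - complex.Im x * complex.Im y.
Proof. by case: x; case: y. Qed.

Lemma Im_mulc (x y : R[i]) :
  complex.Im (x * y) = complex.Re x * complex.Im y + complex.Im x * complex.Re y.
Proof. by case: x => a b; case: y => c d. Qed.

Lemma Re_addc (x y : R[i]) : complex.Re (x + y) = complex.Re x + complex.Re y.
Proof. by case: x; case: y. Qed.

Lemma Im_addc (x y : R[i]) : complex.Im (x + y) = complex.Im x + complex.Im y.
Proof. by case: x; case: y. Qed.

Lemma normc_ReM (x y : R[i]) : `|complex.Re (x * y)| <= normc x * normc y.
Proof. by rewrite -ComplexField.Normc.normcM normc_Re. Qed.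

Lemma normc_ImM (x y : R[i]) : `|complex.Im (x * y)| <= normc x * normc y.
Proof. by rewrite -ComplexField.Normc.normcM normc_Im. Qed.

End complex_modulus.

Lemma cmeasurableM d (T : measurableType d) (R : realType) (f g : T -> R[i]) :
  cmeasurable f -> cmeasurable g -> cmeasurable (fun x => f x * g x).
Proof.
move=> [f1 f2] [g1 g2]; split.
  under eq_fun do rewrite Re_mulc.
  by apply: measurable_funB; apply: measurable_funM.
under eq_fun do rewrite Im_mulc.
by apply: measurable_funD; apply: measurable_funM.
Qed.

Lemma cmeasurable_comp d d' (T : measurableType d) (T' : measurableType d') (R : realType)
    (f : T' -> R[i]) (g : T -> T') :
  cmeasurable f -> measurable_fun setT g -> cmeasurable (fun x => f (g x)).
Proof.
move=> [f1 f2] mg; split; first exact: (measurableT_comp f1 mg).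
exact: (measurableT_comp f2 mg).
Qed.

Lemma abs_Rintegral_le d (T : measurableType d) (R : realType)
    (mu : {measure set T -> \bar R}) (g h : T -> R) :
  measurable_fun setT g -> measurable_fun setT h -> (forall x, `|g x| <= h x) ->
  ((`|\int[mu]_x g x|)%:E <= \int[mu]_x (h x)%:E)%E.
Proof.
move=> mg mh gh; rewrite /Rintegral.
apply: (@le_trans _ _ `|\int[mu]_x (g x)%:E|%E).
  by case: (\int[mu]_x _)%E => [r| |] //=; rewrite normr0 leey.
apply: le_trans (le_abse_integral mu measurableT _) _; first exact/measurable_EFinP.
apply: ge0_le_integral => //.
- by apply/measurableT_comp => //; exact/measurable_EFinP.
- exact/measurable_EFinP.
- by move=> x _; rewrite /= lee_fin.
Qed.

Lemma integral_ae_zero d (T : measurableType d) (R : realType)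
    (mu : {measure set T -> \bar R}) (f : T -> \bar R) :
  (forall x, 0 <= f x)%E -> {ae mu, forall x, f x = 0%E} -> (\int[mu]_x f x = 0)%E.
Proof.
move=> f0 [N [mN N0 fN]]; apply/eqP; rewrite eq_le integral_ge0 ?andbT//.
apply: le_trans (_ : \int[mu]_(x in N) +oo <= _)%E; last first.
  by rewrite integral_cst// N0 mule0.
rewrite [leRHS]integral_mkcond; apply: le_lower_integral => // x.
rewrite patchE; case: ifP => [_|/negbT/negP xN]; first exact: leey.
suff -> : f x = 0%E by [].
by apply: contrapT => fx; apply: xN; apply: mem_set; exact: fN.
Qed.

Lemma poweR_root_le (R : realType) (a b : \bar R) (C p : R) : 0 < p -> 0 <= C ->
  (0 <= a)%E -> (0 <= b)%E -> (a `^ p <= C%:E * b `^ p)%E ->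
  (a <= (C `^ p^-1)%:E * b)%E.
Proof.
move=> p0 C0 a0 b0 h.
have K (x : \bar R) : (0 <= x)%E -> ((x `^ p) `^ p^-1 = x)%E.
  by move=> x0; rewrite -poweRrM mulfV ?gt_eqF// poweRe1.
rewrite -(K a a0) -(K b b0) -poweR_EFin -poweRM ?lee_fin ?poweR_ge0//.
apply: gt0_ler_poweR => //; rewrite ?in_itv/= ?poweR_ge0 ?leey ?mule_ge0 ?poweR_ge0//.
by rewrite invr_ge0 ltW.
Qed.

Section convolution.
Context {R : realType} {G : topologicalGroupType}
  {mu : {measure set (borel G) -> \bar R}} {H : int -> set G}.
Hypothesis HH : open_filtration mu H.
Hypothesis mul_inv : left_invariant mu.
Hypothesis ann_ae : {ae mu, forall t : borel G, exists k, @filtration_annulus G H k t}.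
Local Notation gT := (borel G).
Implicit Types (K x y : gT -> R[i]^o).

Lemma measurable_Rintegral1 (g : gT * gT -> R) : measurable_fun setT g ->
  measurable_fun setT (fun s => \int[mu]_t g (t, s)).
Proof.
move=> mg; have mg' : measurable_fun setT (fun z => (g z)%:E) by exact/measurable_EFinP.
apply: measurableT_comp; first exact: fine_measurable.
under eq_fun do rewrite integralE.
apply: emeasurable_funB.
  have := measurable_integral1 HH (measurable_funepos mg') (fun z => funepos_ge0 _ z).
  by congr measurable_fun; apply/funext => s; apply: eq_integral => t _; rewrite !funeposE.
have := measurable_integral1 HH (measurable_funeneg mg') (fun z => funeneg_ge0 _ z).
by congr measurable_fun; apply/funext => s; apply: eq_integral => t _; rewrite !funenegE.
Qed.

Lemma cmeasurable_conv K x : cmeasurable (K : gT -> R[i]) -> cmeasurable (x : gT -> R[i]) ->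
  cmeasurable (fun z : gT * gT => K z.1 * x (z.1^-1 * z.2)%g : R[i]).
Proof.
move=> mK mx; apply: (cmeasurableM (f := fun z : gT * gT => K z.1)).
  exact: (cmeasurable_comp mK measurable_fst).
exact: (cmeasurable_comp mx (measurable_ldivg HH)).
Qed.

Lemma cmeasurable_conv1 K x s : cmeasurable (K : gT -> R[i]) -> cmeasurable (x : gT -> R[i]) ->
  cmeasurable (fun t : gT => K t * x (t^-1 * s)%g : R[i]).
Proof.
move=> mK mx; apply: (cmeasurableM mK).
exact: (cmeasurable_comp mx (measurable_divg s)).
Qed.

Lemma convolution_measurable K x : cmeasurable (K : gT -> R[i]) ->
  cmeasurable (x : gT -> R[i]) -> cmeasurable (convolution mu K x : gT -> R[i]).
Proof.
move=> mK mx; have [mR mI] := cmeasurable_conv mK mx.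
by split; [exact: (measurable_Rintegral1 mR) | exact: (measurable_Rintegral1 mI)].
Qed.

Local Notation wconv := (@wconv R G mu).

(** Real and imaginary parts are each at most the integral of the modulus, which loses a factor [2].
    Where that integral is infinite the bound holds whatever default value [convolution] takes. *)
Lemma convolution_le K x s : cmeasurable (K : gT -> R[i]) -> cmeasurable (x : gT -> R[i]) ->
  ((normc (convolution mu K x s) / 2)%:E <=
   wconv (fun t => normc (K t)) (fun t => normc (x t)) s)%E.
Proof.
move=> mK mx; have [mg1 mg2] := cmeasurable_conv1 s mK mx.
have mh : measurable_fun setT (fun t : gT => normc (K t) * normc (x (t^-1 * s)%g)).
  exact: (measurable_conv1 s (measurable_normc mK) (measurable_normc mx)).
have b1 := abs_Rintegral_le mu mg1 mh (fun t => normc_ReM _ _).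
have b2 := abs_Rintegral_le mu mg2 mh (fun t => normc_ImM _ _).
rewrite /wconv; set U := (\int[mu]_t _)%E in b1 b2 *.
have h (u a b : R) : u <= a + b -> (a%:E <= U)%E -> (b%:E <= U)%E -> ((u / 2)%:E <= U)%E.
  move: U {b1 b2} => [r| |] //=; rewrite ?leey// !lee_fin; lra.
exact (h _ _ _ (normc_le_ReIm (convolution mu K x s)) b1 b2).
Qed.

Lemma wconv_measurable (w f : gT -> R) : measurable_fun setT w -> measurable_fun setT f ->
  (forall t, 0 <= w t) -> (forall t, 0 <= f t) -> measurable_fun setT (wconv w f).
Proof.
move=> mw mf w0 f0.
apply: (measurable_integral1 HH (F := fun z => (w z.1 * f (z.1^-1 * z.2)%g)%:E)).
  by apply/measurable_EFinP; exact: (measurable_conv HH mw mf).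
by move=> z; rewrite lee_fin mulr_ge0.
Qed.

Lemma sqr_powR_half (t p : R) : 0 <= t -> (t ^+ 2) `^ (p / 2) = t `^ p.
Proof. by move=> t0; rewrite -powR_mulrn// -powRrM mulrC divfK. Qed.

(* Apply the square function bound to [M 1_A], [A] the set where the convolution is
   infinite, and let [M] grow. *)
Lemma wconv_fin_ae p c w b (f : gT -> R) : 1 < p -> 0 <= c ->
  annulus_bound (mu := mu) (H := H) w b c ->
  measurable_fun setT f -> (forall t, 0 <= f t) ->
  (\int[mu]_s (f s `^ p)%:E < +oo)%E -> {ae mu, forall s, (wconv w f s < +oo)%E}.
Proof.
move=> p1 c0 ab mf f0 fint; have p0 : 0 < p by lra.
have [C C0 HC] := square_convolution HH mul_inv ann_ae p1 c0.
have [mw w0 _ _ _] := ab.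
have mU := wconv_measurable mw mf w0 f0.
have U0 s : (0 <= wconv w f s)%E by apply: integral_ge0 => t _; rewrite lee_fin mulr_ge0.
pose A : set gT := wconv w f @^-1` [set +oo%E].
have mA : measurable A by rewrite /A -[X in measurable X]setTI; exact: mU.
have bound (M : R) : 0 <= M ->
    ((M `^ p)%:E * mu A <= C%:E * \int[mu]_s (f s `^ p)%:E)%E.
  move=> M0; pose v (s : gT) := M * \1_A s.
  have v0 s : 0 <= v s by rewrite mulr_ge0.
  have mv : measurable_fun setT v by apply: measurable_funM => //; exact: measurable_indic.
  have vU s : ((v s)%:E <= wconv w f s)%E.
    rewrite /v indicE; case sA : (s \in A); last by rewrite mulr0.
    by move/set_mem: sA => ->; rewrite leey.
  have := HC 1%N (fun=> w) (fun=> b) (fun=> f) (fun=> v) (fun=> ab) (fun=> mf)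
     (fun=> f0) (fun=> mv) (fun=> v0) (fun=> vU).
  under eq_integral do rewrite big_ord1 sqr_powR_half//.
  under [in X in (_ <= X)%E -> _]eq_integral do rewrite big_ord1 sqr_powR_half//.
  apply: le_trans; rewrite -(setIT A) -integral_indic// -ge0_integralZl_EFin ?powR_ge0//.
    apply: le_lower_integral => s; first by rewrite mule_ge0 ?lee_fin ?powR_ge0.
    rewrite -EFinM lee_fin /v indicE; case: (s \in A); rewrite ?mulr1//.
    by rewrite !mulr0 powR0// gt_eqF.
  by apply/measurable_EFinP; exact: measurable_indic.
exists A; split => //; last first.
  move=> s /= /negP; rewrite -leNgt leye_eq => /eqP sy; exact: sy.
have fint0 : (0 <= \int[mu]_s (f s `^ p)%:E)%E.
  by apply: integral_ge0 => s _; rewrite lee_fin powR_ge0.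
have [B BE] : exists B : R, (C%:E * \int[mu]_s (f s `^ p)%:E)%E = B%:E.
  exists (fine (C%:E * \int[mu]_s (f s `^ p)%:E)%E); rewrite fineK// fin_numM//.
  by rewrite ge0_fin_numE.
rewrite BE in bound.
have B0 : 0 <= B by rewrite -lee_fin -BE mule_ge0.
have Afin : mu A \is a fin_num.
  have := bound 1 ler01; rewrite powR1 mul1e => A1.
  by rewrite ge0_fin_numE// (le_lt_trans A1) ?ltry.
have [a aE] : exists a : R, mu A = a%:E by exists (fine (mu A)); rewrite fineK.
have a0 : 0 <= a by rewrite -lee_fin -aE.
rewrite aE in bound *; apply/eqP; rewrite eqe eq_le a0 andbT leNgt; apply/negP => agt0.
(* This [M] gives [M ^ p * a = B + 1], against the bound by [B]. *)
have := bound (((B + 1) / a) `^ p^-1) (powR_ge0 _ _).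
rewrite -powRrM mulVf ?gt_eqF// powRr1; last by rewrite divr_ge0// addr_ge0.
by rewrite -EFinM lee_fin divfK ?gt_eqF//; lra.
Qed.

Lemma convolution_square p c : 1 < p -> 0 <= c -> exists2 C, 0 <= C &
  forall n (K : 'I_n -> gT -> R[i]^o) (b : 'I_n -> int -> R) (x : 'I_n -> gT -> R[i]^o),
    (forall j, cmeasurable (K j : gT -> R[i])) ->
    (forall j, annulus_bound (mu := mu) (H := H) (fun t => normc (K j t)) (b j) c) ->
    (forall j, cmeasurable (x j : gT -> R[i])) ->
    (\int[mu]_s ((\sum_j normc (convolution mu (K j) (x j) s) ^+ 2) `^ (p / 2))%:E <=
     C%:E * \int[mu]_s ((\sum_j normc (x j s) ^+ 2) `^ (p / 2))%:E)%E.
Proof.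
move=> p1 c0; have [C C0 HC] := square_convolution HH mul_inv ann_ae p1 c0.
exists (2 `^ p * C) => [|n K b x mK ab mx]; first by rewrite mulr_ge0 ?powR_ge0.
have mT j := convolution_measurable (mK j) (mx j).
have := HC n (fun j t => normc (K j t)) b (fun j t => normc (x j t))
  (fun j s => normc (convolution mu (K j) (x j) s) / 2) ab.
move=> /(_ (fun j => measurable_normc (mx j)) (fun j t => normc_ge0 _)).
have mv j : measurable_fun setT (fun s : gT => normc (convolution mu (K j) (x j) s) / 2).
  by apply: measurable_funM => //; exact: measurable_normc (mT j).
have v0 j s : 0 <= normc (convolution mu (K j) (x j) s) / 2.
  by rewrite divr_ge0 ?normc_ge0.
move=> /(_ mv v0 (fun j s => convolution_le s (mK j) (mx j))).
set B := (\int[mu]_s ((\sum_j normc (x j s) ^+ 2) `^ (p / 2))%:E)%E => HB.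
rewrite EFinM -muleA.
have -> : (\int[mu]_s ((\sum_j normc (convolution mu (K j) (x j) s) ^+ 2) `^ (p / 2))%:E =
   (2 `^ p)%:E * \int[mu]_s ((\sum_j (normc (convolution mu (K j) (x j) s) / 2) ^+ 2) `^ (p / 2))%:E)%E.
  rewrite -ge0_integralZl_EFin ?powR_ge0//.
  - apply: eq_integral => s _; rewrite -EFinM; congr (_%:E).
    rewrite -(sqr_powR_half p (ler0n R 2)) -powRM ?exprn_ge0//; last first.
      by apply: sumr_ge0 => j _; exact: sqr_ge0.
    congr (_ `^ _); rewrite mulr_sumr; apply: eq_bigr => j _.
    by rewrite -exprMn mulrCA divff ?mulr1.
  - by move=> s _; rewrite lee_fin powR_ge0.
  apply/measurable_EFinP; apply: (measurableT_comp (measurable_powR (p / 2))).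
  by apply: measurable_sum => j; exact: measurable_funX.
by rewrite lee_wpmul2l// lee_fin powR_ge0.
Qed.

Lemma Cnorm_powR p x : p != 0 ->
  (Cnorm mu p%:E (x : gT -> R[i]) `^ p = \int[mu]_s (normc (x s) `^ p)%:E)%E.
Proof.
move=> p0; rewrite /Cnorm powR_Lnorm//; apply: eq_integral => s _.
by rewrite /modulus /= ger0_norm ?normc_ge0.
Qed.

Lemma Cnorm_lty p x : 0 < p ->
  (Cnorm mu p%:E (x : gT -> R[i]) < +oo)%E = (\int[mu]_s (normc (x s) `^ p)%:E < +oo)%E.
Proof.
move=> p0; have pn0 : p != 0 by rewrite gt_eqF.
rewrite -Cnorm_powR//; apply/idP/idP; first exact: poweR_lty.
exact: lty_poweRy.
Qed.

(** Linearity may fail where an integral diverges and takes a default value; [wconv_fin_ae] confines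
    such points to a null set. Elsewhere the real and imaginary integrands are integrable. *)
Lemma convolution_linear_ae p c K b (a : R[i]) x y : 1 < p -> 0 <= c ->
  cmeasurable (K : gT -> R[i]) ->
  annulus_bound (mu := mu) (H := H) (fun t => normc (K t)) b c ->
  CLp mu p%:E x -> CLp mu p%:E y ->
  {ae mu, forall s, convolution mu K (a *: x + y) s =
     a * convolution mu K x s + convolution mu K y s}.
Proof.
move=> p1 c0 mK ab [mx xfin] [my yfin]; have p0 : 0 < p by lra.
have [KR KI] := mK; have [xR xI] := mx; have [yR yI] := my.
have fin (z : gT -> R[i]^o) : cmeasurable (z : gT -> R[i]) -> (Cnorm mu p%:E (z : gT -> R[i]) < +oo)%E ->
  {ae mu, forall s, (wconv (fun t => normc (K t)) (fun t => normc (z t)) s < +oo)%E}.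
  move=> mz zfin; apply: (wconv_fin_ae p1 c0 ab (measurable_normc mz)).
    by move=> t; exact: normc_ge0.
  by rewrite -Cnorm_lty.
have Hx := fin x mx xfin; have Hy := fin y my yfin.
apply: filterS2 Hx Hy => s xs ys.
have int (z : gT -> R[i]^o) : cmeasurable (z : gT -> R[i]) ->
    (wconv (fun t => normc (K t)) (fun t => normc (z t)) s < +oo)%E ->
    mu.-integrable setT (fun t : gT => (complex.Re (K t * z (t^-1 * s)%g))%:E) /\
    mu.-integrable setT (fun t : gT => (complex.Im (K t * z (t^-1 * s)%g))%:E).
  move=> mz zs; have [m1 m2] := cmeasurable_conv1 s mK mz.
  have mh : measurable_fun setT (fun t : gT => normc (K t) * normc (z (t^-1 * s)%g)).
    exact: (measurable_conv1 s (measurable_normc mK) (measurable_normc (f := z : gT -> R[i]) mz)).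
  have ih : mu.-integrable setT (fun t : gT => (normc (K t) * normc (z (t^-1 * s)%g))%:E).
    apply/integrableP; split; first exact/measurable_EFinP.
    apply: le_lt_trans zs; rewrite /wconv le_eqVlt; apply/orP; left; apply/eqP.
    by apply: eq_integral => t _; rewrite /= ger0_norm// mulr_ge0 ?normc_ge0.
  split; apply: (le_integrable measurableT _ _ ih).
  - exact/measurable_EFinP.
  - by move=> t _; rewrite /= lee_fin [leRHS]ger0_norm ?mulr_ge0 ?normc_ge0//; exact: normc_ReM.
  - exact/measurable_EFinP.
  - by move=> t _; rewrite /= lee_fin [leRHS]ger0_norm ?mulr_ge0 ?normc_ge0//; exact: normc_ImM.
have [ixR ixI] := int x mx xs; have [iyR iyI] := int y my ys.
have iZ (r : R) (g : gT -> R) : mu.-integrable setT (fun t => (g t)%:E) ->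
    mu.-integrable setT (fun t => (r * g t)%:E).
  by move=> ig; under eq_fun do rewrite EFinM; exact: integrableZl.
have lin (r1 r2 : R) (g1 g2 g3 : gT -> R) : mu.-integrable setT (fun t => (g1 t)%:E) ->
    mu.-integrable setT (fun t => (g2 t)%:E) -> mu.-integrable setT (fun t => (g3 t)%:E) ->
    \int[mu]_t (r1 * g1 t + r2 * g2 t + g3 t) =
    r1 * \int[mu]_t g1 t + r2 * \int[mu]_t g2 t + \int[mu]_t g3 t.
  move=> i1 i2 i3.
  have i12 : mu.-integrable setT (EFin \o (fun t => r1 * g1 t + r2 * g2 t)).
    exact (integrableD measurableT (iZ r1 _ i1) (iZ r2 _ i2)).
  by rewrite RintegralD// RintegralD ?RintegralZl//; exact: iZ.
case: a => a1 a2.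
have reE (k u v : R[i]) : complex.Re (k * (Complex a1 a2 * u + v)) =
    a1 * complex.Re (k * u) + - a2 * complex.Im (k * u) + complex.Re (k * v).
  by case: k u v => [k1 k2] [u1 u2] [v1 v2] /=; ring.
have imE (k u v : R[i]) : complex.Im (k * (Complex a1 a2 * u + v)) =
    a1 * complex.Im (k * u) + a2 * complex.Re (k * u) + complex.Im (k * v).
  by case: k u v => [k1 k2] [u1 u2] [v1 v2] /=; ring.
rewrite /convolution /Cintegral; congr Complex.
  transitivity (\int[mu]_t (a1 * complex.Re (K t * x (t^-1 * s)%g) +
      - a2 * complex.Im (K t * x (t^-1 * s)%g) + complex.Re (K t * y (t^-1 * s)%g))).
    by apply: eq_Rintegral => t _; exact: reE.
  by rewrite (lin _ _ _ _ _ ixR ixI iyR) mulNr.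
transitivity (\int[mu]_t (a1 * complex.Im (K t * x (t^-1 * s)%g) +
    a2 * complex.Re (K t * x (t^-1 * s)%g) + complex.Im (K t * y (t^-1 * s)%g))).
  by apply: eq_Rintegral => t _; exact: imE.
by rewrite (lin _ _ _ _ _ ixI ixR iyI).
Qed.

(** The norm bound is the square function estimate for a single kernel. *)
Lemma convolution_bounded_operator p c K b : 1 < p -> 0 <= c ->
  cmeasurable (K : gT -> R[i]) ->
  annulus_bound (mu := mu) (H := H) (fun t => normc (K t)) b c ->
  bounded_operator (CLp mu p%:E) (Cnorm mu p%:E) (convolution mu K).
Proof.
move=> p1 c0 mK ab; have p0 : 0 < p by lra.
have [C C0 HC] := convolution_square p1 c0.
have bnd x : cmeasurable (x : gT -> R[i]) ->
    (Cnorm mu p%:E (convolution mu K x : gT -> R[i]) <= (C `^ p^-1)%:E * Cnorm mu p%:E (x : gT -> R[i]))%E.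
  move=> mx; have := HC 1%N (fun=> K) (fun=> b) (fun=> x) (fun=> mK) (fun=> ab) (fun=> mx).
  under eq_integral do rewrite big_ord1 sqr_powR_half ?normc_ge0//.
  under [in X in (_ <= X)%E -> _]eq_integral do rewrite big_ord1 sqr_powR_half ?normc_ge0//.
  rewrite -!Cnorm_powR ?gt_eqF//; apply: poweR_root_le => //; exact: Lnorm_ge0.
split.
- move=> x [mx xfin]; split; first exact: convolution_measurable.
  apply: le_lt_trans (bnd x mx) _; apply: lte_mul_pinfty => //.
  by rewrite lee_fin powR_ge0.
- move=> a x y xp yp; apply: (@poweR_eq0_eq0 _ _ p); first exact: Lnorm_ge0.
  rewrite Cnorm_powR ?gt_eqF//; apply: integral_ae_zero.
    by move=> s; rewrite lee_fin powR_ge0.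
  have [N [mN N0 HN]] := convolution_linear_ae a p1 c0 mK ab xp yp.
  exists N; split=> // s /= ns; apply: HN => /= sE; apply: ns.
  have -> : (convolution mu K (a *: x + y) - (a *: convolution mu K x + convolution mu K y)) s = 0.
    by rewrite !fctE sE subrr.
  by rewrite ComplexField.Normc.normc0 powR0 ?gt_eqF.
by exists (C `^ p^-1) => x [mx _]; exact: bnd.
Qed.

End convolution.

(** * Rademacher means *)

(** Adding [+oo] to [g] on the exceptional null set makes the inequality hold everywhere without
    changing the integral of [g]. *)
Lemma ae_le_lower_integral d (T : measurableType d) (R : realType)
    (mu : {measure set T -> \bar R}) (f g : T -> \bar R) :
  (forall x, 0 <= f x)%E -> (forall x, 0 <= g x)%E -> measurable_fun setT g ->
  {ae mu, forall x, (f x <= g x)%E} -> (\int[mu]_x f x <= \int[mu]_x g x)%E.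
Proof.
move=> f0 g0 mg [N [mN N0 fN]].
pose h : T -> \bar R := (fun=> +oo%E) \_ N.
have h0 x : (0 <= h x)%E by rewrite /h patchE; case: ifP.
have mh : measurable_fun setT h by apply/(measurable_restrictT _ mN).
apply: (@le_trans _ _ (\int[mu]_x (g x + h x))%E).
  apply: le_lower_integral => // x; rewrite /h patchE.
  case: ifP => [_|/negbT/negP xN]; first by rewrite addey ?leey// gt_eqF// (lt_le_trans _ (g0 x)).
  rewrite adde0; apply: contrapT => fx; apply: xN; apply: mem_set; exact: fN.
rewrite ge0_integralD// -integral_mkcond integral_cst// [X in (_ * X)%E]N0 mule0 adde0.
exact: lexx.
Qed.

Lemma oner_eqN1 (R : realType) : ((1 : R) == -1) = false.
Proof. by apply/eqP; lra. Qed.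

Section rademacher_means.
Context d (Omega : measurableType d) (R : realType) (P : probability Omega R)
  (eps : nat -> {RV P >-> R}).
Hypothesis eps_rad : rademacher_sequence eps.

Lemma rademacher_ae : {ae P, forall w, forall k, eps k w = 1 \/ eps k w = -1}.
Proof.
have half2 : 2^-1 + 2^-1 = 1 :> R by lra.
apply/ae_foralln => k; have [_ /(_ k)[P1 PN1]] := eps_rad.
have m (c : R) : measurable (eps k @^-1` [set c]) by exact: measurable_sfunP.
pose E := eps k @^-1` [set 1] `|` eps k @^-1` [set -1].
have mE : measurable E by exact: measurableU.
exists (~` E); split; first exact: measurableC.
- have PE : P E = 1%E.
    rewrite measureU//; last by rewrite -subset0 => w [/= -> /eqP]; rewrite oner_eqN1.
    by rewrite [X in (X + _)%E]P1 [X in (_ + X)%E]PN1 -EFinD half2.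
  transitivity (1 - P E)%E; first exact: probability_setC.
  by rewrite PE subee.
by move=> w /= nw [h|h]; apply: nw; [left|right].
Qed.

(** Variables of index at least [n] are left unconstrained; this extends a sign vector to the family
    of sets indexed by [nat] that independence expects. *)
Let B n (s : {ffun 'I_n -> bool}) (i : nat) : set R :=
  if insub i is Some k then [set (-1) ^+ s k] else setT.

Let A n (s : {ffun 'I_n -> bool}) : set Omega :=
  \bigcap_(i in [set` iota 0 n]) (eps i @^-1` B s i).

Let AP n (s : {ffun 'I_n -> bool}) w : A s w <-> forall k : 'I_n, eps k w = (-1) ^+ s k.
Proof.
split=> [Aw k|Ew i /=]; last first.
  rewrite mem_iota add0n => /= iN; rewrite /B insubT; exact: (Ew (Ordinal iN)).
have := Aw k; rewrite /= mem_iota add0n ltn_ord /B => /(_ isT).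
by rewrite (valK k).
Qed.

Let mB n (s : {ffun 'I_n -> bool}) i : measurable (B s i).
Proof. by rewrite /B; case: insub. Qed.

Let mA n (s : {ffun 'I_n -> bool}) : measurable (A s).
Proof.
rewrite /A bigcap_seq; apply: bigsetI_measurable => i _.
exact: measurable_sfunP.
Qed.

Let PA n (s : {ffun 'I_n -> bool}) : P (A s) = ((2 ^+ n)^-1)%:E.
Proof.
have [ind e2] := eps_rad; rewrite /A ind ?iota_uniq//.
have -> : iota 0 n = index_iota 0 n by rewrite /index_iota subn0.
rewrite big_mkord; under eq_bigr => i _.
  have -> : P (eps i @^-1` B s i) = (2^-1)%:E.
    rewrite /B (valK i); case: (s i); rewrite ?expr0 ?expr1.
      by have [_ ->] := e2 i.
    by have [-> _] := e2 i.
  over.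
rewrite big_const_ord -exprVn; elim: n {s} => [|n IH]; first by rewrite expr0.
by rewrite iterS IH exprS -EFinM.
Qed.

(** Almost surely the first [n] variables form one of the [2 ^ n] sign vectors, each with
    probability [2^-n]. The integrand is compared in both directions with a step function, as they
    may differ on the null set where some variable is not a sign. *)
Lemma rademacher_integral n (Psi : ('I_n -> R) -> \bar R) :
  (forall e, 0 <= Psi e)%E ->
  (\int[P]_w Psi (fun k => eps k w) =
   \sum_(s : {ffun 'I_n -> bool}) ((2 ^+ n)^-1)%:E * Psi (fun k => ((-1) ^+ s k)%R))%E.
Proof.
move=> Psi0; pose sg (s : {ffun 'I_n -> bool}) : 'I_n -> R := fun k => (-1) ^+ s k.
pose g w := (\sum_(s : {ffun 'I_n -> bool}) Psi (sg s) * (\1_(A s) w)%:E)%E.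
have t0 s w : (0 <= Psi (sg s) * (\1_(A s) w)%:E)%E by rewrite mule_ge0// lee_fin.
have mt s : measurable_fun setT (fun w => Psi (sg s) * (\1_(A s) w)%:E)%E.
  by apply: measurable_funeM; apply/measurable_EFinP; exact: measurable_indic.
have mg : measurable_fun setT g by apply: emeasurable_sum.
have g0 w : (0 <= g w)%E by apply: sume_ge0.
have gA (s : {ffun 'I_n -> bool}) w : A s w -> g w = Psi (fun k => eps k w).
  move=> sw; rewrite /g (bigD1 s)//= big1 => [|s' s's].
    rewrite indicE mem_set// mule1 adde0; congr Psi; apply/funext => k.
    by rewrite (AP s w).1.
  rewrite indicE memNset ?mule0// => s'w; move/eqP: s's; apply; apply/ffunP => k.
  have := (AP s' w).1 s'w k; rewrite ((AP s w).1 sw k).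
  by case: (s k); case: (s' k) => //; rewrite expr0 expr1 => /eqP; rewrite ?oner_eqN1// eq_sym oner_eqN1.
have -> : (\int[P]_w Psi (fun k => eps k w) = \int[P]_w g w)%E.
  apply/eqP; rewrite eq_le; apply/andP; split.
    apply: ae_le_lower_integral => //; apply: filterS rademacher_ae => w ew.
    (* A true entry of the vector encodes the sign [-1]. *)
    rewrite (gA [ffun k : 'I_n => eps k w == -1])//; apply/AP => k; rewrite ffunE.
    by case: (ew k) => ->; rewrite ?eqxx ?oner_eqN1.
  apply: le_lower_integral => // w.
  have [[s sw]|ns] := pselect (exists s : {ffun 'I_n -> bool}, A s w); first by rewrite (gA s).
  rewrite /g big1// => s _; rewrite indicE memNset ?mule0// => sw.
  by apply: ns; exists s.
rewrite /g ge0_integral_sum//; apply: eq_bigr => s _.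
rewrite ge0_integralZl//.
- by rewrite integral_indic// setIT [X in (_ * X)%E]PA muleC.
- by apply/measurable_EFinP; exact: measurable_indic.
Qed.

End rademacher_means.

(** * Khintchine's inequalities for complex coefficients, by real and imaginary parts *)

Section complex_khintchine.
Context {R : realType}.

Lemma Re_signed_sum n (e : 'I_n -> R) (x : 'I_n -> R[i]) :
  complex.Re (\sum_k real_complex R (e k) * x k) = \sum_k e k * complex.Re (x k).
Proof.
have Re0 : complex.Re (0 : R[i]) = 0 by [].
rewrite (big_morph (@complex.Re R) (@Re_addc R) Re0).
by apply: eq_bigr => k _; rewrite Re_mulc /= mul0r subr0.
Qed.

Lemma Im_signed_sum n (e : 'I_n -> R) (x : 'I_n -> R[i]) :
  complex.Im (\sum_k real_complex R (e k) * x k) = \sum_k e k * complex.Im (x k).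
Proof.
have Im0 : complex.Im (0 : R[i]) = 0 by [].
rewrite (big_morph (@complex.Im R) (@Im_addc R) Im0).
by apply: eq_bigr => k _; rewrite Im_mulc /= mul0r addr0.
Qed.

Lemma complex_khintchine_upper (p : R) : 0 < p -> exists2 c, 0 < c &
  forall n (x : 'I_n -> R[i]),
    sign_mean (fun e => normc (\sum_k real_complex R (e k) * x k) `^ p) <=
    c * (\sum_k normc (x k) ^+ 2) `^ (p / 2).
Proof.
move=> p0; have [c c0 Hc] := khintchine_upper p0.
exists (2 `^ p * (c + c)) => [|n x]; first by rewrite mulr_gt0 ?powR_gt0 ?addr_gt0.
have part (f : R[i] -> R) : (forall z, `|f z| <= normc z) ->
    (\sum_k f (x k) ^+ 2) `^ (p / 2) <= (\sum_k normc (x k) ^+ 2) `^ (p / 2).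
  move=> fn; apply: powR_le; first by rewrite divr_ge0// ltW.
    by apply: sumr_ge0 => k _; exact: sqr_ge0.
  apply: ler_sum => k _; rewrite -(real_normK (num_real (f _))).
  by rewrite ler_sqr ?nnegrE ?normc_ge0.
apply: le_trans (_ : sign_mean (fun e => 2 `^ p * (`|\sum_k e k * complex.Re (x k)| `^ p +
    `|\sum_k e k * complex.Im (x k)| `^ p)) <= _).
  apply: ler_sign_mean => e; apply: le_trans (powR_add_le _ _ _) => //; last exact: ltW.
  rewrite -Re_signed_sum -Im_signed_sum; apply: powR_le; first exact: ltW.
    exact: normc_ge0.
  exact: normc_le_ReIm.
rewrite sign_meanZ -mulrA ler_wpM2l ?powR_ge0// sign_meanD mulrDl lerD//.
  apply: le_trans (Hc n (fun k => complex.Re (x k))) _; rewrite ler_wpM2l ?(ltW c0)//.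
  by apply: (part (@complex.Re R)); exact: normc_Re.
apply: le_trans (Hc n (fun k => complex.Im (x k))) _; rewrite ler_wpM2l ?(ltW c0)//.
by apply: (part (@complex.Im R)); exact: normc_Im.
Qed.

Lemma complex_khintchine_lower (p : R) : 0 < p -> exists2 c, 0 < c &
  forall n (x : 'I_n -> R[i]),
    (\sum_k normc (x k) ^+ 2) `^ (p / 2) <=
    c * sign_mean (fun e => normc (\sum_k real_complex R (e k) * x k) `^ p).
Proof.
move=> p0; have [c c0 Hc] := khintchine_lower p0.
have r0 : 0 <= p / 2 by rewrite divr_ge0// ltW.
exists (2 `^ (p / 2) * (c + c)) => [|n x]; first by rewrite mulr_gt0 ?powR_gt0 ?addr_gt0.
have -> : \sum_k normc (x k) ^+ 2 =
    \sum_k complex.Re (x k) ^+ 2 + \sum_k complex.Im (x k) ^+ 2.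
  by rewrite -big_split; apply: eq_bigr => k _; rewrite normc_sqr.
apply: le_trans (powR_add_le r0 _ _) _;
  try by apply: sumr_ge0 => k _; exact: sqr_ge0.
rewrite -mulrA ler_wpM2l ?powR_ge0// mulrDl lerD//.
  apply: le_trans (Hc n (fun k => complex.Re (x k))) _; rewrite ler_wpM2l ?(ltW c0)//.
  apply: ler_sign_mean => e; rewrite -Re_signed_sum; apply: powR_le => //; first exact: ltW.
  exact: normc_Re.
apply: le_trans (Hc n (fun k => complex.Im (x k))) _; rewrite ler_wpM2l ?(ltW c0)//.
apply: ler_sign_mean => e; rewrite -Im_signed_sum; apply: powR_le => //; first exact: ltW.
exact: normc_Im.
Qed.

End complex_khintchine.

Section rademacher_norms.
Context d (T : measurableType d) d' (Omega : measurableType d') (R : realType)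
  (mu : {measure set T -> \bar R}) (P : probability Omega R)
  (eps : nat -> {RV P >-> R}) (p : R).
Hypothesis eps_rad : rademacher_sequence eps.
Hypothesis p0 : 0 < p.

Lemma cmeasurable_signed_sum n (e : 'I_n -> R) (x : 'I_n -> T -> R[i]) :
  (forall k, cmeasurable (x k)) ->
  cmeasurable (fun t => \sum_k real_complex R (e k) * x k t).
Proof.
move=> mx; split.
  under eq_fun do rewrite Re_signed_sum.
  apply: measurable_sum => k; apply: measurable_funM => //; exact: (mx k).1.
under eq_fun do rewrite Im_signed_sum.
by apply: measurable_sum => k; apply: measurable_funM => //; exact: (mx k).2.
Qed.

Definition rademacher_mean n (x : 'I_n -> T -> R[i]) (t : T) : R :=
  sign_mean (fun e => normc (\sum_k real_complex R (e k) * x k t) `^ p).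

Lemma measurable_normc_powR (f : T -> R[i]) : cmeasurable f ->
  measurable_fun setT (fun t => (normc (f t) `^ p)%:E).
Proof.
move=> mf; apply/measurable_EFinP.
exact: (measurableT_comp (measurable_powR p) (measurable_normc mf)).
Qed.

Lemma measurable_rademacher_mean n (x : 'I_n -> T -> R[i]) :
  (forall k, cmeasurable (x k)) ->
  measurable_fun setT (fun t => (rademacher_mean x t)%:E).
Proof.
move=> mx; apply/measurable_EFinP; apply: measurable_funM => //.
apply: measurable_sum => s; apply/measurable_EFinP.
exact: (measurable_normc_powR (cmeasurable_signed_sum _ mx)).
Qed.

(** The two exponents agree, so the inner root cancels; the finite mean over signs is then exchanged
    with the integral, leaving a pointwise mean. *)
Lemma rademacher_norm_powR n (x : 'I_n -> T -> R[i]^o) :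
  (forall k, cmeasurable (x k : T -> R[i])) ->
  (rademacher_norm (Cnorm mu p%:E) eps p x `^ p =
   \int[mu]_t (rademacher_mean x t)%:E)%E.
Proof.
move=> mx; rewrite /rademacher_norm powR_Lnorm ?gt_eqF//.
pose Psi (e : 'I_n -> R) := (\int[mu]_t (normc (\sum_k real_complex R (e k) * x k t) `^ p)%:E)%E.
transitivity (\int[P]_w Psi (fun k => eps k w))%E.
  apply: eq_integral => w _; rewrite gee0_abs; last exact: Lnorm_ge0.
  rewrite /Cnorm powR_Lnorm ?gt_eqF//; apply: eq_integral => t _.
  rewrite /modulus /= ger0_norm ?normc_ge0//.
  by rewrite fct_sumE.
rewrite (rademacher_integral eps_rad) => [|e]; last first.
  by apply: integral_ge0 => t _; rewrite lee_fin powR_ge0.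
under eq_bigr => s _.
  rewrite -ge0_integralZl_EFin//; last 2 first.
  - by move=> t _; rewrite lee_fin powR_ge0.
  - exact: (measurable_normc_powR (cmeasurable_signed_sum _ mx)).
  over.
rewrite -ge0_integral_sum//; last 2 first.
- by move=> s; apply: measurable_funeM; exact: (measurable_normc_powR (cmeasurable_signed_sum _ mx)).
- by move=> s t _; rewrite -EFinM lee_fin mulr_ge0 ?powR_ge0 ?invr_ge0 ?exprn_ge0.
apply: eq_integral => t _; under eq_bigr do rewrite -EFinM; rewrite sumEFin.
by rewrite /rademacher_mean /sign_mean mulr_sumr.
Qed.

Lemma measurable_sum_normc n (x : 'I_n -> T -> R[i]) : (forall k, cmeasurable (x k)) ->
  measurable_fun setT (fun t => ((\sum_k normc (x k t) ^+ 2) `^ (p / 2))%:E).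
Proof.
move=> mx; apply/measurable_EFinP; apply: (measurableT_comp (measurable_powR (p / 2))).
by apply: measurable_sum => k; apply: measurable_funX; exact: measurable_normc.
Qed.

Lemma rademacher_mean_upper : exists2 c, 0 < c & forall n (x : 'I_n -> T -> R[i]),
  (forall k, cmeasurable (x k)) ->
  (\int[mu]_t (rademacher_mean x t)%:E <=
   c%:E * \int[mu]_t ((\sum_k normc (x k t) ^+ 2) `^ (p / 2))%:E)%E.
Proof.
have [c c0 Hc] := @complex_khintchine_upper R p p0; exists c => // n x mx.
rewrite -ge0_integralZl_EFin ?(ltW c0)//; last 2 first.
- by move=> t _; rewrite lee_fin powR_ge0.
- exact: measurable_sum_normc.
apply: ge0_le_integral => //.
- by move=> t _; rewrite lee_fin sign_mean_ge0// => e; rewrite powR_ge0.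
- exact: measurable_rademacher_mean.
- by apply: measurable_funeM; exact: measurable_sum_normc.
by move=> t _; rewrite -EFinM lee_fin; exact: Hc.
Qed.

Lemma rademacher_mean_lower : exists2 c, 0 < c & forall n (x : 'I_n -> T -> R[i]),
  (forall k, cmeasurable (x k)) ->
  (\int[mu]_t ((\sum_k normc (x k t) ^+ 2) `^ (p / 2))%:E <=
   c%:E * \int[mu]_t (rademacher_mean x t)%:E)%E.
Proof.
have [c c0 Hc] := @complex_khintchine_lower R p p0; exists c => // n x mx.
rewrite -ge0_integralZl_EFin ?(ltW c0)//; last 2 first.
- by move=> t _; rewrite lee_fin sign_mean_ge0// => e; rewrite powR_ge0.
- exact: measurable_rademacher_mean.
apply: ge0_le_integral => //.
- by move=> t _; rewrite lee_fin powR_ge0.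
- exact: measurable_sum_normc.
- by apply: measurable_funeM; exact: measurable_rademacher_mean.
by move=> t _; rewrite -EFinM lee_fin; exact: Hc.
Qed.

End rademacher_norms.

Theorem theorem5p3 (R : realType) (G : topologicalGroupType) (I : set int)
    (Gk : int -> set G) (mu : {measure set (borel G) -> \bar R}) (C0 p : R) :
  spector_vilenkin I Gk ->
  I = [set: int] \/ I = [set k | 0 <= k] ->
  unimodular R G ->
  left_haar mu -> mu (Gk 0) = 1%E ->
  0 < C0 ->
  1 < p ->
  exists C : R,
    forall (d : measure_display) (Omega : measurableType d)
      (P : probability Omega R) (eps : nat -> {RV P >-> R}),
    rademacher_sequence eps ->
    R_bounded (CLp mu p%:E) (Cnorm mu p%:E) eps p
      (convolution_operators mu I Gk C0) /\
    (R_constant (CLp mu p%:E) (Cnorm mu p%:E) eps p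
      (convolution_operators mu I Gk C0) <= C%:E)%E.
Proof.
move=> sv I_cases _ haar mu1 C00 p1.
have p0 : 0 < p by lra.
have c0 : 0 <= 2 * C0 by lra.
have mul_inv : left_invariant mu by case: haar.
have HH := sv_open_filtration sv I_cases haar mu1.
have ann_ae := sv_annulus_ae sv I_cases haar mu1.
have ab (K : borel G -> R[i]^o) (KC : kernels mu I Gk C0 K) :=
  kernel_annulus_bound sv I_cases haar mu1 KC.
have mK (K : borel G -> R[i]^o) : kernels mu I Gk C0 K -> cmeasurable (K : borel G -> R[i]).
  by case=> [[]].
have [S S0 HS] := convolution_square HH mul_inv ann_ae p1 c0.
have [a a0 Ha] := rademacher_mean_upper mu p0.
have [b b0 Hb] := rademacher_mean_lower mu p0.
have D0 : 0 <= a * S * b by rewrite !mulr_ge0// ltW.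
(* [a] and [b] come from Khintchine's inequalities and [S] from the square function; all three are
   fixed before the probability space is chosen. *)
exists ((a * S * b) `^ p^-1) => d Omega P eps eps_rad.
have bound : R_bound (CLp mu p%:E) (Cnorm mu p%:E) eps p
    (convolution_operators mu I Gk C0) ((a * S * b) `^ p^-1).
  split=> [|n T x n0 FT Xx]; first exact: powR_ge0.
  have /choice[K KP] : forall k, exists K, kernels mu I Gk C0 K /\ convolution mu K = T k.
    by move=> k; have [K KC KT] := FT k; exists K.
  have mx k : cmeasurable (x k : borel G -> R[i]) by case: (Xx k).
  have mT k : cmeasurable (T k (x k) : borel G -> R[i]).
    have [KC <-] := KP k.
    exact: (convolution_measurable HH (mK _ KC) (mx k)).
  apply: poweR_root_le => //; try exact: Lnorm_ge0.
  rewrite !(rademacher_norm_powR _ eps_rad p0)//.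
  apply: le_trans (Ha n _ mT) _; rewrite -[a * S * b]mulrA EFinM -muleA lee_wpmul2l ?lee_fin ?(ltW a0)//.
  apply: (@le_trans _ _ (S%:E * \int[mu]_t ((\sum_k normc (x k t) ^+ 2) `^ (p / 2))%:E)%E).
    apply: le_trans (HS n K _ x (fun k => mK _ (KP k).1) (fun k => ab _ (KP k).1) mx).
    apply: le_lower_integral => t; rewrite lee_fin ?powR_ge0// le_eqVlt; apply/orP; left.
    by apply/eqP; congr (_ `^ _); apply: eq_bigr => k _; have [_ ->] := KP k.
  by rewrite EFinM -muleA lee_wpmul2l ?lee_fin// Hb.
split; last by apply: ereal_inf_lbound; exists ((a * S * b) `^ p^-1).
split; last by exists ((a * S * b) `^ p^-1).
move=> _ [K KC <-].
exact: (convolution_bounded_operator HH mul_inv ann_ae p1 c0 (mK _ KC) (ab _ KC)).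
Qed.
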